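(* If all uncertainty in the economy is generated by a conservative Borel right process $X$ and the pricing kernel $S$ is a positive semimartingale multiplicative functional of $X$ (as specified in the context), then $S$ admits at most one recurrent Hansen–Scheinkman factorization $$S_t=e^{-\lambda t}\frac{\pi(X_0)}{\pi(X_t)}M^\pi_t .$$ That is, the eigenvalue parameter $\lambda$, the positive eigenfunction $\pi$ (up to a multiplicative constant), the martingale $M^\pi$, and the eigen-measure $\mathbb{Q}^\pi$ of such a factorization are unique.
   Context: $E$ is a Lusin space (homeomorphic to a Borel subset of a compact metric space) having at least two points, with Borel sigma-field $\mathscr{E}$; $\mathscr{E}^*$ is the sigma-field of universally measurable subsets of $E$. $X=(\Omega,\mathscr{F},(\mathscr{F}_t)_{t\ge0},(X_t)_{t\ge0},(\mathbb{P}_x)_{x\in E})$ is a conservative Borel right process: a time-homogeneous strong Markov process with values in $E$, with right-continuous paths, shift operators $\theta_t:\Omega\to\Omega$ ($X_s\circ\theta_t=X_{s+t}$), Borel measurable transition function, $\mathbb{P}_x(X_0=x)=1$, and $\mathbb{P}_x(X_t\in E)=1$ for all $t,x$. $(\mathscr{F}_t)$ is the filtration generated by $X$, completed with the $\mathbb{P}_\mu$-null sets for all initial distributions $\mu$ (right-continuous). A process is called a semimartingale/martingale if it is one under $\mathbb{P}_x$ for every $x\in E$. Pricing kernel: $S$ is a strictly positive semimartingale with $S_0=1$, $S_->0$, $S_{t+s}(\omega)=S_t(\omega)S_s(\theta_t\omega)$, and $\mathbb{E}^{\mathbb P}_x[S_t]<\infty$ for all $t>0$, $x\in E$. Pricing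 operators: $\mathscr{P}_tf(x)=\mathbb{E}^{\mathbb P}_x[S_tf(X_t)]$. Hansen–Scheinkman factorization: given a strictly positive finite Borel function $\pi$ and a real $\lambda$ with $\mathscr{P}_t\pi(x)=e^{-\lambda t}\pi(x)$ for all $t\ge0$, $x\in E$, it is the identity $S_t=e^{-\lambda t}\frac{\pi(X_0)}{\pi(X_t)}M^\pi_t$ in which $M_t^\pi=e^{\lambda t}\frac{\pi(X_t)}{\pi(X_0)}S_t$ is a positive martingale with $M^\pi_0=1$. The associated eigen-measure is $\mathbb{Q}^\pi=(\mathbb{Q}^\pi_x)_{x\in E}$, $\mathbb{Q}^\pi_x|_{\mathscr{F}_t}=M^\pi_t\,\mathbb{P}_x|_{\mathscr{F}_t}$. The factorization is called recurrent if $X$ is recurrent under $\mathbb{Q}^\pi$. Recurrence: with $R(x,B)=\int_0^\infty P_t(x,B)\,dt$, where $P_t(x,\cdot)$ is the transition function of $X$ under the measure considered, $X$ is recurrent if for each $B\in\mathscr{E}^*$ either $R(x,B)=0$ for all $x\in E$ or $R(x,B)=\infty$ for all $x\in E$. *)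

(* Defs.v *)
From HB Require Import structures.
From mathcomp Require Import all_boot all_order all_algebra.
From mathcomp Require Import all_classical all_reals all_analysis.
From mathcomp Require Import measurable_realfun.

Set Implicit Arguments.
Unset Strict Implicit.
Unset Printing Implicit Defensive.

Import Order.TTheory GRing.Theory Num.Theory.
Import numFieldNormedType.Exports.

Local Open Scope classical_set_scope.
Local Open Scope ring_scope.

(* The time axis is [0, +oo[ inside R: processes are functions of t : R, and
   only their values at 0 <= t are ever constrained. *)

Section state_space.
Context (R : realType).

Definition lusin_space (E : topologicalType) : Prop :=
  exists (K : metricType R) (f : E -> K),
    [/\ compact [set: K],
        injective f,
        (* f is a homeomorphism of E onto the subspace range f *)
        @open E = [set f @^-1` V | V in @open K] &
        <<s @open K >> (range f)].

Definition borel (E : ptopologicalType) := g_sigma_algebraType (@open E).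

(* Membership in the completion of the sigma-field G with respect to m. *)
Definition completion (T : Type) (G : set_system T) (m : set T -> \bar R) :
    set_system T :=
  [set A | exists B C, [/\ G B, G C, B `<=` A, A `<=` C & m (C `\` B) = 0%E]].

Definition universally_measurable (E : ptopologicalType) : set_system E :=
  [set A | forall mu : probability (borel E) R,
     completion <<s @open E >> mu A].

End state_space.

Section filtered_space.
Context (R : realType) d (Omega : measurableType d).
Variables (Pr : probability Omega R) (F : R -> set_system Omega).

Definition adapted (Y : R -> Omega -> R) : Prop :=
  forall t : R, 0 <= t -> forall B : set R, measurable B -> F t (Y t @^-1` B).

Definition stopping_time (T : Omega -> \bar R) : Prop :=
  (forall w, (0 <= T w)%E) /\
  (forall t : R, 0 <= t -> F t [set w | (T w <= t%:E)%E]).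

Definition stopped_sigma_field (T : Omega -> \bar R) : set_system Omega :=
  [set A | measurable A /\
     forall t : R, 0 <= t -> F t (A `&` [set w | (T w <= t%:E)%E])].

Definition martingale (M : R -> Omega -> R) : Prop :=
  [/\ adapted M,
      (forall t : R, 0 <= t -> Pr.-integrable setT (fun w => (M t w)%:E)) &
      (forall s t : R, 0 <= s -> s <= t -> forall A, F s A ->
         (\int[Pr]_(w in A) (M t w)%:E = \int[Pr]_(w in A) (M s w)%:E)%E)].

Definition cadlag (f : R -> R) : Prop :=
  (forall t : R, 0 <= t -> f s @[s --> t^'+] --> f t) /\
  (forall t : R, 0 < t -> cvg (f s @[s --> t^'-])).

Definition stopped (Y : R -> Omega -> R) (T : Omega -> \bar R) :
    R -> Omega -> R :=
  fun t w => Y (fine (Order.min (T w) t%:E)) w.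

Definition local_martingale (N : R -> Omega -> R) : Prop :=
  [/\ adapted N,
      {ae Pr, forall w, cadlag (N ^~ w)} &
      exists T : nat -> Omega -> \bar R,
        [/\ (forall n, stopping_time (T n)),
            (forall n w, (T n w <= T n.+1 w)%E),
            {ae Pr, forall w, T n w @[n --> \oo] --> +oo%E} &
            (forall n, martingale (stopped N (T n)))]].

Definition finite_variation_process (A : R -> Omega -> R) : Prop :=
  [/\ adapted A,
      {ae Pr, forall w, cadlag (A ^~ w)} &
      {ae Pr, forall w, forall t : R, 0 <= t -> bounded_variation 0 t (A ^~ w)}].

Definition semimartingale (Y : R -> Omega -> R) : Prop :=
  adapted Y /\
  exists N A : R -> Omega -> R,
    [/\ local_martingale N, finite_variation_process A,
        {ae Pr, forall w, N 0 w = 0 /\ A 0 w = 0} &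
        {ae Pr, forall w, forall t : R, 0 <= t ->
           Y t w = Y 0 w + N t w + A t w}].

End filtered_space.

Section process.
Context (R : realType) (E : ptopologicalType).
Context d (Omega : measurableType d).
Variables (X : R -> Omega -> E) (theta : R -> Omega -> Omega).
Variable P : E -> probability Omega R.

Definition cylinders (I : set R) : set_system Omega :=
  [set A | exists s (B : set E),
     [/\ I s, <<s @open E >> B & A = X s @^-1` B]].

Definition raw_sigma_field : set_system Omega := <<s cylinders `[0, +oo[ >>.

Definition raw_filtration (t : R) : set_system Omega :=
  <<s cylinders `[0, t] >>.

(* P_mu for an initial law mu; only used on raw events, where x |-> P x A is
   Borel. *)
Definition initial_law (mu : probability (borel E) R) (A : set Omega) :
    \bar R :=
  (\int[mu]_x P x A)%E.

Definition null_sets (mu : probability (borel E) R) : set_system Omega :=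
  [set N | exists A, [/\ raw_sigma_field A, initial_law mu A = 0%E &
                         N `<=` A]].

Definition filtration (t : R) : set_system Omega :=
  [set A | forall mu, <<s raw_filtration t `|` null_sets mu >> A].

(* The sigma-field of the measurableType Omega is the augmented one, F.
   X takes its values in E (there is no cemetery point), so that X is
   conservative. *)
Record borel_right_process : Prop := BorelRightProcess {
  right_continuous_paths : forall w (t : R), 0 <= t ->
    X s w @[s --> t^'+] --> X t w;
  shiftE : forall (s t : R) w, 0 <= s -> 0 <= t -> X s (theta t w) = X (s + t) w;
  augmentedE : forall A : set Omega, measurable A <->
    forall mu, completion raw_sigma_field (initial_law mu) A;
  right_continuous_filtration : forall (t : R) A, 0 <= t ->
    (forall s, t < s -> filtration s A) -> filtration t A;
  normalE : forall x, P x (X 0 @^-1` [set x]) = 1%E;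
  (* contains, for A = X t @^-1` B, the Borel measurability of the
     transition function *)
  borel_kernel : forall A, raw_sigma_field A ->
    measurable_fun [set: borel E] ((fun x => P x A) : borel E -> \bar R);
  (* P_x(theta_T^-1 A | F_T) = P_{X_T}(A) on the event T < oo *)
  strong_markov : forall T, stopping_time filtration T ->
    forall H, stopped_sigma_field filtration T H ->
    forall A, raw_sigma_field A -> forall x,
      P x (H `&` [set w | (T w < +oo)%E /\ A (theta (fine (T w)) w)]) =
      (\int[P x]_(w in H `&` [set w | T w < +oo]) P (X (fine (T w)) w) A)%E
}.

Record pricing_kernel (S : R -> Omega -> R) : Prop := PricingKernel {
  pk_gt0 : forall (t : R) w, 0 <= t -> 0 < S t w;
  pk_0 : forall w, S 0 w = 1;
  pk_mul : forall (s t : R) w, 0 <= s -> 0 <= t ->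
    S (t + s) w = S t w * S s (theta t w);
  pk_semimartingale : forall x, semimartingale (P x) filtration S;
  pk_left_gt0 : forall x, {ae P x, forall w, forall t : R, 0 < t ->
    0 < lim (S s w @[s --> t^'-])};
  pk_finite : forall (t : R) x, 0 < t -> (\int[P x]_w (S t w)%:E < +oo)%E
}.

Definition pricing_operator (S : R -> Omega -> R) (t : R) (f : E -> R)
    (x : E) : \bar R :=
  (\int[P x]_w (S t w * f (X t w))%:E)%E.

Record HS_factorization (S : R -> Omega -> R) (lam : R) (pi : E -> R)
    (M : R -> Omega -> R) : Prop := HSFactorization {
  hs_borel : measurable_fun [set: borel E] (pi : borel E -> R);
  hs_pi_gt0 : forall x, 0 < pi x;
  hs_eigen : forall (t : R) x, 0 <= t ->
    pricing_operator S t pi x = (expR (- lam * t) * pi x)%:E;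
  hs_martingaleE : forall (t : R) w, 0 <= t ->
    M t w = expR (lam * t) * (pi (X t w) / pi (X 0 w)) * S t w;
  hs_identity : forall (t : R) w, 0 <= t ->
    S t w = expR (- lam * t) * (pi (X 0 w) / pi (X t w)) * M t w;
  hs_gt0 : forall (t : R) w, 0 <= t -> 0 < M t w;
  hs_0 : forall w, M 0 w = 1;
  hs_martingale : forall x, martingale (P x) filtration M
}.

(* The eigen-measure is specified by its restrictions Q_x|F_t = M_t P_x|F_t,
   hence on the union of the F_t. It is not required to be a measure on the
   augmented F: Q_x may be singular to P_x there, whereas each F_t already
   contains every P-null set, so in general no such measure exists. *)
Definition eigen_measure (M : R -> Omega -> R) (Q : E -> set Omega -> \bar R) :
    Prop :=
  forall x (t : R) A, 0 <= t -> filtration t A ->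
    Q x A = (\int[P x]_(w in A) (M t w)%:E)%E.

End process.

Section recurrence.
Context (R : realType) (E : ptopologicalType).
Variable P_ : R -> E -> set E -> \bar R.

Definition potential (x : E) (B : set E) : \bar R :=
  (\int[lebesgue_measure]_(t in `[0%R, +oo[) P_ t x B)%E.

Definition recurrent : Prop :=
  forall B, universally_measurable R B ->
    (forall x, potential x B = 0%E) \/ (forall x, potential x B = +oo%E).

End recurrence.

Section recurrent_factorization.
Context (R : realType) (E : ptopologicalType).
Context d (Omega : measurableType d).
Variables (X : R -> Omega -> E) (P : E -> probability Omega R).

Definition transition_function (Q : E -> set Omega -> \bar R) (t : R) (x : E)
    (B : set E) : \bar R :=
  Q x (X t @^-1` B).

Record recurrent_HS_factorization (S : R -> Omega -> R) (lam : R) (pi : E -> R)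
    (M : R -> Omega -> R) (Q : E -> set Omega -> \bar R) : Prop :=
  RecurrentHSFactorization {
    rhs_factorization : HS_factorization X P S lam pi M;
    rhs_eigen_measure : eigen_measure X P M Q;
    rhs_recurrent : recurrent (transition_function Q)
  }.

(* m is an honest family of probability measures on the raw sigma-field
   sigma(X_t, t >= 0) that prolongs Q. *)
Definition extends_eigen_measure (Q : E -> set Omega -> \bar R)
    (m : E -> probability (g_sigma_algebraType (cylinders X `[0, +oo[)) R) :
    Prop :=
  forall x (t : R) A, 0 <= t -> raw_filtration X t A -> m x A = Q x A.

End recurrent_factorization.

(* Main.v *)
Require Import Defs.
From mathcomp Require Import all_boot all_order all_algebra.
From mathcomp Require Import all_classical all_reals all_analysis.
From mathcomp Require Import measurable_realfun.
From mathcomp Require Import finmap ring lra.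
From HB Require Import structures.

(* Let P_t be the semigroup of X under the first eigen-measure and
   h = pi2 / pi1; then P_t h = e^(a t) h with a = lam1 - lam2, and by symmetry
   we may assume a <= 0. So h and all its truncations f = min(h, c) are
   supermedian. If P_s f dropped strictly between two positive times, then for
   a suitable t the potential of {f - P_t f > epsilon} would be positive but
   finite (telescoping), against recurrence: P_s f does not depend on s > 0.
   Letting c grow, e^(a s) h does not depend on s > 0, so a = 0. Suppose now
   h(z) < b < h(y) and put f = min(h, b). As P_1 (f - P_1 f) = 0, some z' has
   h(z') < b and P_1 f (z') = h(z'); hence P_s (h - f) (z') = 0 for every s and
   {h > b} has potential 0 at z', although P_s 1_{h > b} (y) is bounded below
   uniformly in s > 0. So h is constant.

   M_t is only measurable for the augmented filtration, so the P_t act on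
   universally measurable functions, and the Markov property has to be
   extended from raw events to augmented ones. *)

Set Implicit Arguments.
Unset Strict Implicit.
Unset Printing Implicit Defensive.

Import Order.TTheory GRing.Theory Num.Theory.
Import numFieldNormedType.Exports.
Import HBNNSimple.

Local Open Scope classical_set_scope.
Local Open Scope ring_scope.

(** * Integrals against densities and mixtures *)

Section integration.
Local Open Scope ereal_scope.

(** A nonnegative measurable function is an increasing limit of simple functions, and each of those
    is a finite sum of nonnegative multiples of indicators; the four clauses follow this
    construction. *)
Lemma ge0_measurable_fun_ind d (T : measurableType d) (R : realType)
    (P : (T -> \bar R) -> Prop) :
  (forall A, measurable A -> P (EFin \o \1_A)) ->
  (forall (k : R) f, (0 <= k)%R -> measurable_fun setT f ->
    (forall x, 0 <= f x) -> P f -> P (fun x => k%:E * f x)) ->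
  (forall f g, measurable_fun setT f -> (forall x, 0 <= f x) ->
    measurable_fun setT g -> (forall x, 0 <= g x) ->
    P f -> P g -> P (fun x => f x + g x)) ->
  (forall f_ : nat -> T -> \bar R, (forall n, measurable_fun setT (f_ n)) ->
    (forall n x, 0 <= f_ n x) -> (forall x, nondecreasing_seq (f_ ^~ x)) ->
    (forall n, P (f_ n)) -> P (fun x => limn (f_ ^~ x))) ->
  forall f, measurable_fun setT f -> (forall x, 0 <= f x) -> P f.
Proof.
move=> P1 PZ PD Plim f mf f0.
pose f_ := nnsfun_approx measurableT mf.
have -> : f = fun x => limn (fun n => (f_ n x)%:E).
  apply/funext => x; apply/esym/cvg_lim => //.
  exact: cvg_nnsfun_approx.
apply: (Plim (fun n x => (f_ n x)%:E)).
- by move=> n; exact/measurable_EFinP.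
- by move=> n x; rewrite lee_fin.
- by move=> x m n mn; rewrite lee_fin; exact/lefP/nd_nnsfun_approx.
move=> n.
have mi A : measurable A -> measurable_fun setT (EFin \o (\1_A : T -> R)).
  by move=> mA; exact/measurable_EFinP.
have -> : (fun x => (f_ n x)%:E) = fun x =>
    \sum_(y <- (fset_set (range (f_ n)) : seq R)) y%:E * (\1_(f_ n @^-1` [set y]) x)%:E.
  by apply/funext => x; rewrite fimfunE fsbig_finite//= -sumEFin.
have s0 y : y \in (fset_set (range (f_ n)) : seq R) -> (0 <= y)%R.
  by rewrite in_fset_set// => /set_mem[x _ <-].
(* The induction is on an arbitrary list of nonnegative values, the level sets of [f_ n] staying
   fixed; the empty sum is the indicator of the empty set. *)
elim: (fset_set _ : seq R) s0 => [|a s IH] s0.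
  under eq_fun do rewrite big_nil.
  have -> : (fun=> 0) = (EFin \o (\1_set0 : T -> R)).
    by apply/funext => x /=; rewrite indic0.
  exact: P1.
have a0 : (0 <= a)%R by apply: s0; rewrite mem_head.
have {}s0 y : y \in s -> (0 <= y)%R.
  by move=> ys; apply: s0; rewrite in_cons ys orbT.
under eq_fun do rewrite big_cons.
have mf_ y : measurable (f_ n @^-1` [set y]) by [].
apply: PD => //.
- by apply: measurable_funeM; exact: mi.
- by move=> x; rewrite mule_ge0// lee_fin.
- rewrite (_ : (fun _ => _) = fun x => \sum_(y <- s)
      (y%:E * (\1_(f_ n @^-1` [set y]) x)%:E)) //.
  by apply: emeasurable_sum => y; apply: measurable_funeM; exact: mi.
- move=> x; rewrite big_seq sume_ge0// => y ys.
  by rewrite mule_ge0// lee_fin// s0.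
- by apply: (PZ _ (EFin \o _)) => //; [exact: mi|by move=> x /=; rewrite lee_fin|exact: P1].
- exact: IH.
Qed.


(** The properties shared by evaluation at a point, integrals and iterated integrals on nonnegative
    measurable functions. They reduce the equality of two such functionals to indicators. *)
Definition ge0_linear d (T : measurableType d) (R : realType)
    (K : (T -> \bar R) -> \bar R) : Prop :=
  [/\ forall f, measurable_fun setT f -> (forall x, 0 <= f x) -> 0 <= K f,
      forall f g, measurable_fun setT f -> (forall x, 0 <= f x) ->
        measurable_fun setT g -> (forall x, f x <= g x) -> K f <= K g,
      forall (k : R) f, (0 <= k)%R -> measurable_fun setT f ->
        (forall x, 0 <= f x) -> K (fun x => k%:E * f x) = k%:E * K f,
      forall f g, measurable_fun setT f -> (forall x, 0 <= f x) ->
        measurable_fun setT g -> (forall x, 0 <= g x) ->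
        K (fun x => f x + g x) = K f + K g &
      forall f_ : nat -> T -> \bar R, (forall n, measurable_fun setT (f_ n)) ->
        (forall n x, 0 <= f_ n x) -> (forall x, nondecreasing_seq (f_ ^~ x)) ->
        K (fun x => limn (f_ ^~ x)) = limn (fun n => K (f_ n))].

Lemma ge0_linear_ext d (T : measurableType d) (R : realType)
    (I J : (T -> \bar R) -> \bar R) :
  ge0_linear I -> ge0_linear J ->
  (forall A, measurable A -> I (EFin \o \1_A) = J (EFin \o \1_A)) ->
  forall f, measurable_fun setT f -> (forall x, 0 <= f x) -> I f = J f.
Proof.
move=> [_ _ IZ ID Il] [_ _ JZ JD Jl] IJ.
apply: ge0_measurable_fun_ind => //.
- by move=> k f k0 mf f0 e; rewrite IZ// JZ// e.
- by move=> f g mf f0 mg g0 ef eg; rewrite ID// JD// ef eg.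
- move=> f_ mf f0 nd e; rewrite Il// Jl//.
  by congr (limn _); apply/funext.
Qed.

Lemma ge0_linear_eval d (T : measurableType d) (R : realType) (x : T) :
  ge0_linear (fun f : T -> \bar R => f x).
Proof. by []. Qed.

Lemma ge0_linearZ d (T : measurableType d) (R : realType) (c : R)
    (K : (T -> \bar R) -> \bar R) :
  (0 <= c)%R -> ge0_linear K -> ge0_linear (fun f => c%:E * K f).
Proof.
move=> c0 [K0 Kle KZ KD Kl]; split.
- by move=> f mf f0; rewrite mule_ge0// K0.
- by move=> f g mf f0 mg fg; rewrite lee_wpmul2l// Kle.
- by move=> k f k0 mf f0; rewrite KZ// !muleA (muleC c%:E).
- by move=> f g mf f0 mg g0; rewrite KD// ge0_muleDr// K0.
- move=> f_ mf f0 nd; rewrite Kl// -limeMl//.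
  by apply: ereal_nondecreasing_is_cvgn => m n mn; apply: Kle => // x; exact: nd.
Qed.

(** Each clause passes from the functionals [L w] to their integral in [w], the last one by monotone
    convergence. This covers iterated integrals. *)
Lemma ge0_linear_integral d (T : measurableType d) d' (S : measurableType d')
    (R : realType) (mu : {measure set S -> \bar R}) (D : set S)
    (L : S -> (T -> \bar R) -> \bar R) :
  measurable D -> (forall w, ge0_linear (L w)) ->
  (forall f, measurable_fun setT f -> (forall x, 0 <= f x) ->
    measurable_fun D (L ^~ f)) ->
  ge0_linear (fun f => \int[mu]_(w in D) L w f).
Proof.
move=> mD lL mL; split.
- by move=> f mf f0; apply: integral_ge0 => w _; case: (lL w) => + _ _ _ _; exact.
- move=> f g mf f0 mg fg.
  have g0 x : 0 <= g x by rewrite (le_trans (f0 x)).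
  apply: ge0_le_integral => //; [|exact: mL|exact: mL|].
  + by move=> w _; case: (lL w) => + _ _ _ _; exact.
  + by move=> w _; case: (lL w) => _ + _ _ _; exact.
- move=> k f k0 mf f0; rewrite -ge0_integralZl_EFin//; last 2 first.
  + by move=> w _; case: (lL w) => + _ _ _ _; exact.
  + exact: mL.
  by apply: eq_integral => w _; case: (lL w) => _ _ + _ _; exact.
- move=> f g mf f0 mg g0; rewrite -ge0_integralD//; first last.
  + exact: mL.
  + by move=> w _; case: (lL w) => + _ _ _ _; exact.
  + exact: mL.
  + by move=> w _; case: (lL w) => + _ _ _ _; exact.
  by apply: eq_integral => w _; case: (lL w) => _ _ _ + _; exact.
- move=> f_ mf f0 nd; rewrite -monotone_convergence//; first last.
  + move=> w _ m n mn; case: (lL w) => _ + _ _ _; apply => // x; exact: nd.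
  + by move=> n w _; case: (lL w) => + _ _ _ _; exact.
  + by move=> n; exact: mL.
  by apply: eq_integral => w _; case: (lL w) => _ _ _ _; exact.
Qed.

Lemma ge0_linear_integral_id d (T : measurableType d) (R : realType)
    (mu : {measure set T -> \bar R}) :
  ge0_linear (fun f => \int[mu]_x f x).
Proof. by apply: ge0_linear_integral => // w; exact: ge0_linear_eval. Qed.

Section density_pushforward.
Context d d' (S : measurableType d) (T : measurableType d') (R : realType).
Variables (mu : {measure set S -> \bar R}) (W : S -> R) (X : S -> T).
Hypotheses (W0 : forall w, (0 <= W w)%R) (mW : measurable_fun setT W).
Hypothesis mX : measurable_fun setT X.

(** The image under [X] of the measure with density [W] with respect to [mu]. The proofs are
    arguments so that the measure structure declared below can be inferred from the term. *)
Definition density_pushforward (_ : forall w, (0 <= W w)%R)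
    (_ : measurable_fun setT W) (_ : measurable_fun setT X) (B : set T) :
    \bar R :=
  \int[mu]_(w in X @^-1` B) (W w)%:E.

Local Notation nu := (density_pushforward W0 mW mX).

Let nu_set0 : nu set0 = 0.
Proof. by rewrite /density_pushforward preimage_set0 integral_set0. Qed.

Let nu_ge0 B : 0 <= nu B.
Proof. by apply: integral_ge0 => w _; rewrite lee_fin. Qed.

Let nu_additive : semi_sigma_additive nu.
Proof.
have mX' B : measurable B -> measurable (X @^-1` B).
  by move=> mB; rewrite -[_ @^-1` _]setTI; exact: mX.
move=> F mF tF mUF; rewrite /density_pushforward preimage_bigcup.
apply: (@semi_sigma_additive_nng_induced _ _ _ mu (EFin \o W)).
- exact/measurable_EFinP.
- by move=> w; rewrite lee_fin.
- by move=> n; exact: mX'.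
- apply/trivIsetP => /= i j _ _ ij; rewrite -preimage_setI.
  by move/trivIsetP : tF => /(_ _ _ _ _ ij) ->//; rewrite preimage_set0.
- by rewrite -preimage_bigcup; exact: mX'.
Qed.

HB.instance Definition _ := isMeasure.Build _ _ _ nu nu_set0 nu_ge0 nu_additive.

Lemma integral_density_pushforward (f : T -> \bar R) :
  measurable_fun setT f -> (forall x, 0 <= f x) ->
  \int[nu]_x f x = \int[mu]_w ((W w)%:E * f (X w)).
Proof.
move: f; apply: ge0_linear_ext.
- exact: ge0_linear_integral_id.
- apply: ge0_linear_integral => //.
  + by move=> w; apply: ge0_linearZ => //; exact: ge0_linear_eval.
  + move=> f mf f0; apply: emeasurable_funM; first exact/measurable_EFinP.
    exact: measurableT_comp.
move=> A mA; rewrite integral_indic// setIT /=.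
rewrite /density_pushforward integral_mkcond; apply: eq_integral => w _.
rewrite patchE -EFinM indicE (_ : (w \in X @^-1` A) = (X w \in A)); last first.
  by apply/idP/idP => /set_mem h; exact/mem_set.
by case: (_ \in _); rewrite ?mulr1 ?mulr0.
Qed.

End density_pushforward.

Section image_measure.
Context d d' (S : measurableType d) (T : measurableType d') (R : realType).
Variables (mu : {measure set S -> \bar R}) (X : S -> T).
Hypothesis mX : measurable_fun setT X.

Definition image_measure : {measure set T -> \bar R} :=
  density_pushforward mu (W := cst 1%R) (fun=> ler01) (measurable_cst _) mX.

Lemma image_measureE A : measurable A -> image_measure A = mu (X @^-1` A).
Proof.
move=> mA; rewrite /image_measure/= /density_pushforward.
have mXA : measurable (X @^-1` A) by rewrite -[_ @^-1` _]setTI; exact: mX.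
by rewrite -[LHS]/(\int[mu]_(w in X @^-1` A) (cst 1%E w)) integral_cst// mul1e.
Qed.

Lemma integral_image_measure (f : T -> \bar R) :
  measurable_fun setT f -> (forall x, 0 <= f x) ->
  \int[image_measure]_x f x = \int[mu]_w f (X w).
Proof.
move=> mf f0; rewrite integral_density_pushforward//.
by under eq_integral do rewrite mul1e.
Qed.

End image_measure.

Section mixture.
Context d d' (S : measurableType d) (T : measurableType d') (R : realType).
Variables (mu : {measure set S -> \bar R}) (k : S -> {measure set T -> \bar R}).
Hypothesis mk : forall A, measurable A -> measurable_fun setT (k ^~ A).

(** The composition of [mu] with the kernel [k]; the measurability proof is an argument so that the
    measure structure can be inferred. *)
Definition mixture
    (_ : forall A, measurable A -> measurable_fun setT (k ^~ A)) (A : set T) :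
    \bar R :=
  \int[mu]_x k x A.

Local Notation nu := (mixture mk).

Let nu_set0 : nu set0 = 0.
Proof. by rewrite /mixture integral0_eq. Qed.

Let nu_ge0 B : 0 <= nu B.
Proof. exact: integral_ge0. Qed.

Let nu_additive : semi_sigma_additive nu.
Proof.
move=> F mF tF mUF; rewrite /mixture.
rewrite (_ : (fun n => _) = fun n => \int[mu]_x \sum_(0 <= i < n) k x (F i)).
  under eq_integral.
    by move=> x _; rewrite measure_semi_bigcup//; over.
  apply: cvg_monotone_convergence => //.
  - by move=> n; apply: emeasurable_sum => m; exact: mk.
  - by move=> n x _; rewrite sume_ge0.
  - by move=> x _ m n mn; exact: ereal_nondecreasing_series.
by apply/funext => n; rewrite -ge0_integral_sum// => i; exact: mk.
Qed.

HB.instance Definition _ := isMeasure.Build _ _ _ nu nu_set0 nu_ge0 nu_additive.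

Lemma integral_mixture (f : T -> \bar R) :
  measurable_fun setT f -> (forall x, 0 <= f x) ->
  \int[nu]_y f y = \int[mu]_x \int[k x]_y f y.
Proof.
move: f; apply: ge0_linear_ext.
- exact: ge0_linear_integral_id.
- apply: ge0_linear_integral => //.
  + by move=> w; exact: ge0_linear_integral_id.
  + by move=> f mf f0; exact: measurable_fun_integral_kernel.
move=> A mA; rewrite integral_indic// setIT /=.
by apply: eq_integral => x _; rewrite integral_indic// setIT.
Qed.

End mixture.

End integration.

(** * Recurrent semigroups *)

Section lower_integral.
Local Open Scope ereal_scope.

(* The integrands are not assumed measurable, since [t |-> P_t x B] is not
   known to be: for a nonnegative integrand the integral is a supremum over the
   simple functions below it, hence still monotone. *)
Lemma ge0_le_lower_integral d (T : measurableType d) (R : realType)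
    (mu : {measure set T -> \bar R}) (D : set T) (f g : T -> \bar R) :
  (forall x, D x -> 0 <= f x) -> (forall x, D x -> f x <= g x) ->
  \int[mu]_(x in D) f x <= \int[mu]_(x in D) g x.
Proof.
move=> f0 fg; have g0 x : D x -> 0 <= g x.
  by move=> Dx; rewrite (le_trans (f0 x Dx))// fg.
rewrite !ge0_integralE//; apply: le_ereal_sup => _ [h hf <-]; exists h => // x.
by apply: (le_trans (hf x)); rewrite !patchE; case: ifPn => // /set_mem /fg.
Qed.

Lemma lower_integral_gt0 (R : realType) (f : R -> \bar R) (e s : R) :
  (0 < e)%R -> (0 < s)%R -> (forall t, (0 <= t)%R -> 0 <= f t) ->
  (forall t, (0 < t)%R -> (t <= s)%R -> e%:E <= f t) ->
  0 < \int[lebesgue_measure]_(t in `[0%R, +oo[) f t.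
Proof.
move=> e0 s0 f0 ef.
apply: (@lt_le_trans _ _ (\int[lebesgue_measure]_(t in `]0%R, s]) cst e%:E t)).
  rewrite integral_cst//= lebesgue_measure_itv/= lte_fin s0 -EFinD -EFinM lte_fin.
  by rewrite oppr0 addr0 mulr_gt0.
rewrite integral_mkcond [leRHS]integral_mkcond.
apply: ge0_le_lower_integral => t _; rewrite !patchE; case: ifPn => //=.
  by rewrite lee_fin ltW.
  move=> /set_mem/=; rewrite in_itv/= => /andP[t0 ts].
  by rewrite mem_set ?ef//= in_itv/= ltW.
by move=> _; case: ifPn => // /set_mem/=; rewrite in_itv/= andbT => /f0.
Qed.

(** The integrand is dominated by a step function, constant on intervals of length [u], whose
    integral telescopes because [G] is bounded and nonincreasing. *)
Lemma lower_integral_decrement_lty (R : realType) (f : R -> \bar R)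
    (G : R -> R) (c C u : R) :
  (0 <= C)%R -> (0 < u)%R ->
  (forall t, (0 <= t)%R -> (0 <= G t <= c)%R) ->
  (forall s t, (0 <= s)%R -> (s <= t)%R -> (G t <= G s)%R) ->
  (forall t, (0 <= t)%R -> 0 <= f t) ->
  (forall t, (0 <= t)%R -> f t <= (C * (G t - G (t + u)))%:E) ->
  \int[lebesgue_measure]_(t in `[0%R, +oo[) f t < +oo.
Proof.
move=> C0 u0 Gc Gd f0 fG.
pose I n := [set` `[(n%:R * u)%R, (n.+1%:R * u)%R[].
(* For [t] in [I n], monotonicity gives [G t <= G (n u)], while [t + u <= (n + 2) u] bounds
   [G (t + u)] from below; hence the index [n.+2]. *)
pose a n := (C * (G (n%:R * u) - G (n.+2%:R * u)))%R.
have a0 n : (0 <= a n)%R.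
  rewrite mulr_ge0// subr_ge0 Gd//; first by rewrite mulr_ge0// ltW.
  by rewrite ler_pM2r// ler_nat -addn2 leq_addr.
pose g n (t : R) := (a n)%:E * (\1_(I n) t)%:E.
have g0 n t : 0 <= g n t by rewrite mule_ge0// lee_fin.
have mI n : measurable_fun setT (fun t : R => (\1_(I n) t)%:E : \bar R).
  by apply/measurable_EFinP/measurable_indic; exact: measurable_itv.
have mg n : measurable_fun setT (g n).
  exact: measurable_funeM.
apply: (@le_lt_trans _ _ (\int[lebesgue_measure]_(t in setT) \sum_(n <oo) g n t)).
  rewrite integral_mkcond; apply: ge0_le_lower_integral => t _.
    by rewrite patchE; case: ifPn => // /set_mem/=; rewrite in_itv/= andbT => /f0.
  rewrite patchE; case: ifPn => [/set_mem/=|_]; last exact: nneseries_ge0.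
  rewrite in_itv/= andbT => t0.
  have tu0 : (0 <= t / u)%R by rewrite divr_ge0// ltW.
  pose n := Num.truncn (t / u).
  have /andP[nt tn] : (n%:R <= t / u < n.+1%:R)%R.
    by rewrite -truncn_eq.
  have tnI : (n%:R * u <= t < n.+1%:R * u)%R.
    by rewrite -ler_pdivlMr// nt -ltr_pdivrMr.
  apply: (@le_trans _ _ (g n t)).
    rewrite /g indicE mem_set ?mule1/=; last by rewrite /I/= in_itv.
    apply: (le_trans (fG _ t0)); rewrite lee_fin ler_wpM2l//.
    case/andP: tnI => h1 h2; rewrite lerB//.
      by apply: Gd => //; rewrite mulr_ge0// ltW.
    apply: Gd; first by rewrite addr_ge0// ltW.
    by rewrite -addn1 natrD mulrDl mul1r lerD2r ltW.
  have : \sum_(0 <= k < n.+1) g k t <= \sum_(k <oo) g k t.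
    exact: nneseries_lim_ge.
  apply: le_trans.
  by rewrite big_nat_recr//= leeDr// sume_ge0.
rewrite integral_nneseries//.
have LI n : lebesgue_measure (I n) = u%:E.
  rewrite lebesgue_measure_itv/= lte_fin ltr_pM2r// ltr_nat ltnSn -EFinB.
  by rewrite -mulrBl -natrB// subSnn mul1r.
have Ig n : \int[lebesgue_measure]_x g n x = (a n * u)%:E.
  rewrite ge0_integralZl_EFin//; last exact: mI.
  rewrite integral_indic//; last exact: measurable_itv.
  rewrite setIT (_ : (a n * u)%:E = (a n)%:E * u%:E)//.
  by rewrite -(LI n).
under eq_eseriesr do rewrite Ig.
(* Telescoping with step two leaves two initial terms, each at most [c]. *)
apply: (@le_lt_trans _ _ (C * (2 * c) * u)%:E); last exact: ltry.
apply: lime_le.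
  by apply: is_cvg_nneseries => n _ _; rewrite lee_fin mulr_ge0// ltW.
near=> n; rewrite sumEFin lee_fin -mulr_suml ler_wpM2r//; first exact: ltW.
rewrite -mulr_sumr ler_wpM2l//.
have -> m : (\sum_(0 <= i < m) (G (i%:R * u) - G (i.+2%:R * u)) =
    G (0%:R * u) + G (1%:R * u) - (G (m%:R * u) + G (m.+1%:R * u)))%R.
  elim: m => [|m IH]; first by rewrite big_geq// subrr.
  by rewrite big_nat_recr//= IH; ring.
have Gu m : (0 <= G (m%:R * u) <= c)%R by apply: Gc; rewrite mulr_ge0// ltW.
move: (Gu 0%N) (Gu 1%N) (Gu n) (Gu n.+1).
by move=> /andP[? ?] /andP[? ?] /andP[? ?] /andP[? ?]; lra.
Unshelve. all: by end_near. Qed.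

End lower_integral.

(** Integrate the pointwise bounds e 1_B <= g <= e + c 1_B against a measure of total mass one. *)
Lemma expectation_level_bounds d (T : measurableType d) (R : realType)
    (m : {measure set T -> \bar R}) (g : T -> R) (c e : R) :
  m setT = 1%E -> measurable_fun setT g ->
  (forall x, 0 <= g x <= c) -> 0 <= e ->
  let B := [set x | e <= g x] in
  (\int[m]_x (g x)%:E <= e%:E + c%:E * m B)%E /\
  (e%:E * m B <= \int[m]_x (g x)%:E)%E.
Proof.
move=> m1 mg g0c e0 B.
have mB : measurable B.
  by rewrite -[B]setTI; apply: measurable_fun_le.
have c0 : 0 <= c by case/andP: (g0c point) => a; exact: le_trans.
have mI : measurable_fun setT (fun x => (\1_B x)%:E : \bar R).
  exact/measurable_EFinP.
split.
  rewrite -[e%:E]mule1 -m1 -integral_cst//.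
  have -> : m B = (\int[m]_x (\1_B x)%:E)%E by rewrite integral_indic// setIT.
  rewrite -ge0_integralZl_EFin//=.
  rewrite -ge0_integralD//=; last 2 first.
  - by move=> x _; rewrite mule_ge0// lee_fin.
  - exact: measurable_funeM.
  apply: ge0_le_integral => //=.
  - by move=> x _; rewrite lee_fin; case/andP: (g0c x).
  - exact/measurable_EFinP.
  - by apply: emeasurable_funD => //; exact: measurable_funeM.
  move=> x _; rewrite -EFinM -EFinD lee_fin indicE.
  case: (boolP (x \in B)) => [_|/negP xB].
    by rewrite mulr1; case/andP: (g0c x) => _ ?; rewrite ler_wpDl.
  rewrite mulr0 addr0 leNgt; apply/negP => /ltW eg; apply: xB.
  exact/mem_set.
have -> : m B = (\int[m]_x (\1_B x)%:E)%E by rewrite integral_indic// setIT.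
rewrite -ge0_integralZl_EFin//=.
apply: ge0_le_integral => //=.
- by move=> x _; rewrite mule_ge0// lee_fin.
- exact: measurable_funeM.
- exact/measurable_EFinP.
move=> x _; rewrite -EFinM lee_fin indicE.
case: (boolP (x \in B)) => [/set_mem|_]; first by rewrite mulr1.
by rewrite mulr0; case/andP: (g0c x).
Qed.

Lemma measurable_superlevel d (T : measurableType d) (R : realType)
    (g : T -> R) (c : R) :
  measurable_fun setT g -> measurable [set x | c < g x].
Proof.
by move=> mg; rewrite -[X in measurable X]setTI -preimage_itvoy; exact: mg.
Qed.

Lemma ge0_integral_eq0_null d (T : measurableType d) (R : realType)
    (m : {measure set T -> \bar R}) (f : T -> \bar R) :
  measurable_fun setT f -> (forall x, 0 <= f x)%E ->
  (\int[m]_x f x = 0)%E ->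
  exists N, [/\ measurable N, m N = 0%E & forall x, ~ N x -> f x = 0%E].
Proof.
move=> mf f0 f_eq0.
have : (\int[m]_x `|f x| = 0)%E.
  by rewrite -[RHS]f_eq0; apply: eq_integral => x _; rewrite gee0_abs.
move=> /(ae_eq_integral_abs m measurableT mf)[N [mN N0 fN]].
exists N; split => // x Nx; apply: contrapT => fx.
by apply: Nx; apply: fN => /= /(_ Logic.I).
Qed.

Lemma integral_eq0_measure_gt0 d (T : measurableType d) (R : realType)
    (m : {measure set T -> \bar R}) (g : T -> R) :
  measurable_fun setT g -> (forall x, 0 <= g x) ->
  (\int[m]_x (g x)%:E = 0)%E -> m [set x | 0 < g x] = 0%E.
Proof.
move=> mg g0 /ge0_integral_eq0_null[|x|N [mN N0 gN]]; first exact/measurable_EFinP.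
  by rewrite lee_fin.
apply: (subset_measure0 (measurable_superlevel _ mg) mN _ N0) => x /= gx.
by apply: contrapT => /gN[] gx0; rewrite gx0 ltxx in gx.
Qed.

(** * Eigenvalues and positive eigenfunctions of a recurrent Markov semigroup *)

Section recurrent_semigroup.
Context d (T : measurableType d) (R : realType).
Variable K : R -> T -> {measure set T -> \bar R}.
Hypothesis mK : forall t B, 0 <= t -> measurable B ->
  measurable_fun setT (fun x => K t x B).
Hypothesis K1 : forall t x, 0 <= t -> K t x setT = 1%E.
Hypothesis KK : forall s t x (f : T -> R) c, 0 <= s -> 0 <= t ->
  measurable_fun setT f -> (forall y, 0 <= f y <= c) ->
  (\int[K (s + t) x]_y (f y)%:E = \int[K s x]_y \int[K t y]_z (f z)%:E)%E.
Hypothesis K_rec : forall B, measurable B ->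
  (forall x, \int[lebesgue_measure]_(t in `[0%R, +oo[) K t x B = 0)%E \/
  (forall x, \int[lebesgue_measure]_(t in `[0%R, +oo[) K t x B = +oo)%E.
Variables (h : T -> R) (a : R).
Hypotheses (mh : measurable_fun setT h) (h0 : forall x, 0 < h x) (a0 : a <= 0).
Hypothesis Kh : forall t x, 0 <= t ->
  (\int[K t x]_y (h y)%:E = (expR (a * t) * h x)%:E)%E.

(** This is P_t min(h, c) for the semigroup [K]. For [c] and [t] nonnegative the integral lies
    between 0 and [c], so [fine] loses nothing. *)
Definition truncated_mean (c t : R) (x : T) : R :=
  fine (\int[K t x]_y (Num.min (h y) c)%:E)%E.
Local Notation F := truncated_mean.

Let m_trunc c : measurable_fun setT (fun y => Num.min (h y) c).
Proof. exact: measurable_minr. Qed.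

Let mE_trunc c : measurable_fun setT (fun y => (Num.min (h y) c)%:E).
Proof. exact/measurable_EFinP. Qed.

Let trunc_ge0 c y : 0 <= c -> (0 <= (Num.min (h y) c)%:E)%E.
Proof. by move=> c0; rewrite lee_fin le_min c0 ltW. Qed.

Let integral_cstK t x (r : R) : 0 <= t -> (\int[K t x]__ r%:E = r%:E)%E.
Proof. by move=> t0; rewrite -/(cst _) integral_cst// K1// mule1. Qed.

Lemma truncated_meanE c t x : 0 <= c -> 0 <= t ->
  (\int[K t x]_y (Num.min (h y) c)%:E = (F c t x)%:E)%E.
Proof.
move=> c0 t0; rewrite fineK// ge0_fin_numE; last first.
  by apply: integral_ge0 => y _; exact: trunc_ge0.
apply: (@le_lt_trans _ _ (\int[K t x]__ c%:E)%E); last first.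
  by rewrite integral_cstK// ltry.
by apply: ge0_le_integral => // y _; rewrite ?trunc_ge0// lee_fin ge_min lexx orbT.
Qed.

Lemma truncated_mean_ge0 c t x : 0 <= c -> 0 <= F c t x.
Proof.
by move=> c0; apply/fine_ge0/integral_ge0 => y _; exact: trunc_ge0.
Qed.

(** The truncation is supermedian: its mean is at most that of [h], which is e^(a t) h <= h since
    [a <= 0], and at most [c] since [K] has mass one. *)
Lemma truncated_mean_le c t x : 0 <= c -> 0 <= t -> F c t x <= Num.min (h x) c.
Proof.
move=> c0 t0; rewrite -lee_fin -truncated_meanE// EFin_min le_min; apply/andP; split.
  apply: (@le_trans _ _ (\int[K t x]_y (h y)%:E)%E).
    apply: ge0_le_integral => //.
    - by move=> y _; exact: trunc_ge0.
    - exact/measurable_EFinP.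
    - by move=> y _; rewrite lee_fin ge_min lexx.
  rewrite Kh// lee_fin -[leRHS]mul1r ler_pM2r// -expR0 ler_expR.
  by rewrite mulr_le0_ge0.
rewrite -[leRHS](integral_cstK x c t0).
by apply: ge0_le_integral => // y _; rewrite ?trunc_ge0// lee_fin ge_min lexx orbT.
Qed.

Lemma measurable_truncated_mean c t : 0 <= c -> 0 <= t ->
  measurable_fun setT (F c t).
Proof.
move=> c0 t0; apply/measurable_EFinP.
rewrite (_ : EFin \o _ = fun x => \int[K t x]_y (Num.min (h y) c)%:E)%E.
  apply: measurable_fun_integral_kernel => //.
  - by move=> U mU; exact: mK.
  - by move=> y; exact: trunc_ge0.
by apply/funext => x /=; rewrite truncated_meanE.
Qed.

Lemma truncated_meanK c s t x : 0 <= c -> 0 <= s -> 0 <= t ->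
  (\int[K s x]_y (F c t y)%:E = (F c (s + t) x)%:E)%E.
Proof.
move=> c0 s0 t0; rewrite -truncated_meanE// ?addr_ge0// (KK x (c := c))//.
  by apply: eq_integral => y _; rewrite truncated_meanE.
by move=> y; rewrite -lee_fin trunc_ge0//= ge_min lexx orbT.
Qed.

Lemma truncated_mean_nincr c s t x : 0 <= c -> 0 <= s -> s <= t ->
  F c t x <= F c s x.
Proof.
move=> c0 s0 st; have ts0 : 0 <= t - s by rewrite subr_ge0.
rewrite -lee_fin -[t](subrKC s) -truncated_meanK// -truncated_meanE//.
apply: ge0_le_integral => //.
- by move=> y _; rewrite lee_fin truncated_mean_ge0.
- by apply/measurable_EFinP; exact: measurable_truncated_mean.
- by move=> y _; rewrite lee_fin truncated_mean_le.
Qed.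

Let decrement c t y := Num.min (h y) c - F c t y.

Let m_decrement c t : 0 <= c -> 0 <= t -> measurable_fun setT (decrement c t).
Proof. by move=> c0 t0; apply: measurable_funB => //; exact: measurable_truncated_mean. Qed.

Let decrement_ge0 c t y : 0 <= c -> 0 <= t -> 0 <= decrement c t y.
Proof. by move=> c0 t0; rewrite subr_ge0 truncated_mean_le. Qed.

Let integral_decrement c s t x : 0 <= c -> 0 <= s -> 0 <= t ->
  (\int[K s x]_y (decrement c t y)%:E = (F c s x - F c (s + t) x)%:E)%E.
Proof.
move=> c0 s0 t0; rewrite EFinB -truncated_meanE// -truncated_meanK//.
(* The difference is obtained from additivity for nonnegative integrands: min(h, c) is the sum of
   its decrement and its mean after time [t]. *)
apply/esym; rewrite -[X in (X - _)%E]/(\int[K s x]_y (Num.min (h y) c)%:E)%E.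
rewrite (_ : \int[K s x]_y (Num.min (h y) c)%:E =
  \int[K s x]_y (decrement c t y)%:E + \int[K s x]_y (F c t y)%:E)%E.
  by rewrite addeK// truncated_meanK.
rewrite -ge0_integralD//=.
- by apply: eq_integral => y _; rewrite -EFinD subrK.
- by move=> y _; rewrite lee_fin decrement_ge0.
- by apply/measurable_EFinP; exact: m_decrement.
- by move=> y _; rewrite lee_fin truncated_mean_ge0.
- by apply/measurable_EFinP; exact: measurable_truncated_mean.
Qed.

Let K_fin t x B : 0 <= t -> measurable B -> K t x B \is a fin_num.
Proof.
move=> t0 mB; rewrite ge0_fin_numE// (@le_lt_trans _ _ 1%E) ?ltry//.
rewrite -(K1 x t0); apply: le_measure => //; exact: mem_set.
Qed.

(* If [F c] dropped by [delta] between [s] and [t], the set where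
   [min h c] exceeds its mean after time [t] by [delta / 2] would have
   positive and finite potential. *)
Lemma truncated_mean_cst c s t x : 0 < c -> 0 < s -> s <= t ->
  F c t x = F c s x.
Proof.
move=> c0 s0 st; have t0 : 0 < t by exact: lt_le_trans st.
have c0' := ltW c0; have s0' := ltW s0; have t0' := ltW t0.
apply/eqP; rewrite eq_le truncated_mean_nincr//= leNgt; apply/negP => lt_ts.
pose delta := F c s x - F c t x; have delta0 : 0 < delta by rewrite subr_gt0.
pose B := [set y | delta / 2 <= decrement c t y].
have mB : measurable B.
  by rewrite -[B]setTI; apply: measurable_fun_le => //; exact: m_decrement.
have bounds r : 0 <= r ->
    ((F c r x - F c (r + t) x)%:E <= (delta / 2)%:E + c%:E * K r x B)%E /\
    ((delta / 2)%:E * K r x B <= (F c r x - F c (r + t) x)%:E)%E.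
  move=> r0; rewrite -integral_decrement//.
  apply: expectation_level_bounds.
  - exact: K1.
  - exact: m_decrement.
  - move=> y; rewrite decrement_ge0//= lerBlDr; apply: (@le_trans _ _ c).
      by rewrite ge_min lexx orbT.
    by rewrite lerDl truncated_mean_ge0.
  - by rewrite divr_ge0// ltW.
case: (K_rec mB) => /(_ x).
  apply/eqP; rewrite gt_eqF//.
  (* For 0 < r <= s monotonicity gives [F c r x >= F c s x] and [F c (r + t) x <= F c t x], so the
     mean decrement is at least [delta] and [K r x B] at least [delta / 2 / c]: the potential is not
     0. *)
  apply: (@lower_integral_gt0 _ _ (delta / 2 / c) s) => //.
    by rewrite !divr_gt0.
  move=> r r0 rs; have [+ _] := bounds r (ltW r0).
  rewrite -(fineK (K_fin x (ltW r0) mB)) -EFinM -EFinD !lee_fin.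
  rewrite ler_pdivrMr// mulrC => le1.
  have : delta <= F c r x - F c (r + t) x.
    rewrite lerB//; first by apply: truncated_mean_nincr; rewrite // ltW.
    by apply: truncated_mean_nincr; rewrite // lerDr ltW.
  by lra.
apply/eqP; rewrite lt_eqF//.
(* Markov's inequality bounds [K r x B] by [2 / delta] times the decrement of [F c] from [r] to
   [r + t]: the potential is not infinite. *)
apply: (@lower_integral_decrement_lty _ _ (F c ^~ x) c (2 / delta) t) => //.
- by rewrite divr_ge0// ltW.
- move=> r r0; rewrite truncated_mean_ge0//=.
  by rewrite (le_trans (truncated_mean_le _ _ _))// ge_min lexx orbT.
- by move=> r u r0 ru; exact: truncated_mean_nincr.
- move=> r r0; have [_ +] := bounds r r0.
  rewrite -(fineK (K_fin x r0 mB)) -EFinM !lee_fin => le1.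
  by rewrite mulrAC ler_pdivlMr// mulrC; lra.
Qed.


Lemma truncated_mean_cst1 c s x : 0 < c -> 0 < s -> F c s x = F c 1 x.
Proof.
move=> c0 s0; have [s1|/ltW s1] := leP s 1; last exact: truncated_mean_cst.
by apply/esym; exact: truncated_mean_cst.
Qed.

(** Monotone convergence as the truncation level grows. The levels [n.+1] are positive, as required
    for the means to be constant in positive time. *)
Lemma truncated_mean_cvg t x : 0 <= t ->
  F n.+1%:R t x @[n --> \oo] --> expR (a * t) * h x.
Proof.
move=> t0; pose g n y := (Num.min (h y) n.+1%:R)%:E.
have gE y : limn (g ^~ y) = (h y)%:E.
  apply/cvg_lim => //; apply: cvg_near_cst; near=> n.
  rewrite /g min_l// ltW// (lt_le_trans (truncnS_gt (h y)))// ler_nat ltnS.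
  by near: n; exact: nbhs_infty_ge.
suff : (F n.+1%:R t x)%:E @[n --> \oo] --> (expR (a * t) * h x)%:E.
  by move=> /fine_cvg.
rewrite -Kh//; under eq_fun do rewrite -truncated_meanE//.
under eq_integral do rewrite -gE.
apply: cvg_monotone_convergence => //.
- by move=> n; exact: mE_trunc.
- by move=> n y _; exact: trunc_ge0.
- move=> y _ n m nm; rewrite lee_fin le_min ge_min lexx/= ge_min.
  by rewrite ler_nat ltnS nm orbT.
Unshelve. all: by end_near. Qed.

(** At times 1 and 2 the truncated means coincide, hence so do their limits e^a h and e^(2a) h at
    one point, where [h] is positive. *)
Lemma recurrent_eigenvalue_eq0 : a = 0.
Proof.
have lim1 := @truncated_mean_cvg 1 point ler01.
have lim2 := @truncated_mean_cvg 2 point (ler0n _ 2).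
have e : expR (a * 1) * h point = expR (a * 2) * h point.
  rewrite -(cvg_lim _ lim1)// -(cvg_lim _ lim2)//.
  by congr (limn _); apply/funext => n; rewrite (truncated_mean_cst1 point (s := 2)).
have /expR_inj : expR (a * 1) = expR (a * 2).
  by apply: (mulIf (lt0r_neq0 (h0 point))); exact: e.
by lra.
Qed.

Lemma recurrent_eigenfunction_cst y z : h y <= h z.
Proof.
have a_eq0 := recurrent_eigenvalue_eq0.
have Kh1 s x : 0 <= s -> (\int[K s x]_u (h u)%:E = (h x)%:E)%E.
  by move=> s0; rewrite Kh// a_eq0 mul0r expR0 mul1r.
rewrite leNgt; apply/negP => hzy.
pose b := (h z + h y) / 2.
have hzb : h z < b by rewrite /b; lra.
have hby : b < h y by rewrite /b; lra.
have b0 : 0 < b by exact: lt_trans hzb.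
have b0' := ltW b0.
have mhE : measurable_fun setT (fun u => (h u)%:E) by exact/measurable_EFinP.
(* Otherwise the decrement of min(h, b) is positive on all of {h < b}. Its mean under [K 1 z] is
   zero, so that set would be null and [h z], the mean of [h], would be at least [b]. *)
have [z' hz'b dz'] : exists2 z', h z' < b & decrement b 1 z' = 0.
  apply: contrapT => noz.
  have /integral_eq0_measure_gt0 N0 :
      (\int[K 1 z]_u (decrement b 1 u)%:E = 0)%E.
    by rewrite integral_decrement// truncated_mean_cst1// subrr.
  have : (\int[K 1 z]__ b%:E <= \int[K 1 z]_u (h u)%:E)%E.
    apply: ae_ge0_le_integral => //.
      by move=> u _; rewrite lee_fin ltW.
    exists [set u | 0 < decrement b 1 u]; split.
    - by apply: measurable_superlevel; exact: m_decrement.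
    - by apply: N0 => [|u]; [exact: m_decrement|exact: decrement_ge0].
    - move=> u /= hbu; rewrite lt_neqAle decrement_ge0// andbT eq_sym.
      apply/eqP => du; apply: noz; exists u => //; rewrite ltNge; apply/negP => bu.
      by apply: hbu => _; rewrite lee_fin.
  by rewrite integral_cstK// Kh1// lee_fin leNgt hzb.
(* For positive times this is constancy in time; at time 0 the value is squeezed between [F b 1 z']
   and min(h, b) at [z'], both equal to [h z']. *)
have Fz' s : 0 <= s -> F b s z' = h z'.
  move=> s0; have F1 : F b 1 z' = h z'.
    by apply/esym/eqP; rewrite -subr_eq0 -{1}(min_l (ltW hz'b)) -/(decrement b 1 z') dz'.
  rewrite le_eqVlt in s0; case/predU1P: s0 => [<-|s0]; last first.
    by rewrite truncated_mean_cst1.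
  apply/eqP; rewrite eq_le (le_trans (truncated_mean_le _ _ _))// ?ge_min ?lexx//=.
  by rewrite -F1 truncated_mean_nincr.
pose B := [set u | b < h u].
have mB : measurable B by exact: measurable_superlevel.
(* The excess [h - min h b] is positive exactly on [B], and its mean at [z'] is
   [h z' - h z' = 0]. *)
have K0 s : 0 <= s -> K s z' B = 0%E.
  move=> s0; pose v u := h u - Num.min (h u) b.
  have -> : B = [set u | 0 < v u].
    by apply/seteqP; split => u /=; rewrite /v subr_gt0 gt_min ltxx.
  have mv : measurable_fun setT v by exact: measurable_funB.
  have v0 u : 0 <= v u by rewrite subr_ge0 ge_min lexx.
  apply: integral_eq0_measure_gt0 => //.
  have : (\int[K s z']_u (v u)%:E + (F b s z')%:E = (h z')%:E)%E.
    rewrite -truncated_meanE// -(Kh1 s)// -ge0_integralD//=.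
    - by apply: eq_integral => u _; rewrite -EFinD subrK.
    - by move=> u _; rewrite lee_fin.
    - exact/measurable_EFinP.
    - by move=> u _; exact: trunc_ge0.
  rewrite Fz'// => /(congr1 (fun e => e - (h z')%:E)%E).
  by rewrite addeK// subee.
have [pot0|potoo] := K_rec mB; last first.
  have := potoo z'; rewrite integral0_eq// => t /=.
  by rewrite in_itv/= andbT => /K0.
(* The truncated means at [y] tend to [h y > b], while [F b 1 y <= b]. *)
have [n bn] : exists n, F b 1 y < F n.+1%:R 1 y.
  apply: contrapT => /forallNP Fn.
  have := @truncated_mean_cvg 1 y ler01; rewrite a_eq0 mul0r expR0 mul1r => Fcvg.
  have : h y <= b.
    rewrite -(cvg_lim _ Fcvg)//; apply: limr_le; first by apply/cvg_ex; exists (h y).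
    near=> n; have /negP := Fn n; rewrite -leNgt => /le_trans; apply.
    by rewrite (le_trans (truncated_mean_le _ _ _))// ge_min lexx orbT.
  by rewrite leNgt hby.
have : (0 < \int[lebesgue_measure]_(t in `[0%R, +oo[) K t y B)%E.
  (* From min(h, n+1) <= (n+1) 1_B + min(h, b) comes a lower bound for [K s y B]; constancy of the
     truncated means frees it from [s > 0]. *)
  apply: (@lower_integral_gt0 _ _ ((F n.+1%:R 1 y - F b 1 y) / n.+1%:R) 1) => //.
    by rewrite divr_gt0// subr_gt0.
  move=> s s0 _; have s0' := ltW s0.
  rewrite -(fineK (K_fin y s0' mB)) lee_fin ler_pdivrMr// lerBlDl.
  rewrite -(truncated_mean_cst1 y (ltr0Sn _ n) s0) -(truncated_mean_cst1 y b0 s0).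
  rewrite -lee_fin EFinD EFinM -!truncated_meanE// fineK ?K_fin//.
  have -> : K s y B = (\int[K s y]_u (\1_B u)%:E)%E by rewrite integral_indic// setIT.
  rewrite muleC -ge0_integralZl_EFin//=; last exact/measurable_EFinP.
  have mIB : measurable_fun setT (fun u => n.+1%:R%:E * (\1_B u)%:E : \bar R)%E.
    by apply: measurable_funeM; exact/measurable_EFinP.
  rewrite -ge0_integralD//=; last first.
    by move=> u _; exact: trunc_ge0.
  apply: ge0_le_integral => //=.
  - by move=> u _; exact: trunc_ge0.
  - exact: emeasurable_funD.
  move=> u _; rewrite -EFinM -EFinD lee_fin indicE.
  case: (boolP (u \in B)) => [_|/negP uB].
    by rewrite mulr1 ler_wpDl ?ge_min ?lexx ?orbT// le_min b0' ltW.
  rewrite mulr0 addr0 le_min ge_min lexx/= ge_min.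
  by rewrite [h u <= b]leNgt; case: ltP => // bu; case: uB; exact/mem_set.
by rewrite pot0 ltxx.
Unshelve. all: by end_near. Qed.

End recurrent_semigroup.

(** * Universal completion *)

Section completion.
Context d (T : measurableType d) (R : realType) (m : {measure set T -> \bar R}).

Lemma completion_sigma_algebra : sigma_algebra setT (completion measurable m).
Proof.
split.
- by exists set0, set0; split=> //; rewrite setD0 measure0.
- move=> A [B [C [mB mC BA AC CB0]]]; rewrite setTD.
  exists (~` C), (~` B); split; [exact: measurableC|exact: measurableC| | |].
  + exact: subsetC.
  + exact: subsetC.
  + by rewrite setDE setCK setIC -setDE.
- move=> A_ /choice[B_ /choice[C_ BC]].
  exists (\bigcup_n B_ n), (\bigcup_n C_ n).
  have mB n : measurable (B_ n) by case: (BC n).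
  have mC n : measurable (C_ n) by case: (BC n).
  split.
  + exact: bigcup_measurable.
  + exact: bigcup_measurable.
  + by apply: subset_bigcup => n _; case: (BC n).
  + by apply: subset_bigcup => n _; case: (BC n).
  + apply/negligibleP.
      by apply: measurableD; exact: bigcup_measurable.
    apply: (@negligibleS _ _ _ _ (\bigcup_n (C_ n `\` B_ n))).
      move=> x [[n _ Cx] nBx]; exists n => //; split => // Bx.
      by apply: nBx; exists n.
    apply: negligible_bigcup => n; apply/negligibleP; first exact: measurableD.
    by case: (BC n).
Qed.

Lemma completion_eq_off_null (A B N : set T) :
  measurable B -> measurable N -> m N = 0%E ->
  (forall x, ~ N x -> A x <-> B x) -> completion measurable m A.
Proof.
move=> mB mN N0 AB; exists (B `\` N), (B `|` N); split.
- exact: measurableD.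
- exact: measurableU.
- by move=> x [Bx Nx]; apply/AB.
- by move=> x Ax; have [Nx|Nx] := pselect (N x); [right|left; apply/AB].
- apply: (subset_measure0 _ mN _ N0).
    by apply: measurableD; [exact: measurableU|exact: measurableD].
  by move=> x [[Bx|//] /not_andP[//|/contrapT]].
Qed.

End completion.

Section universal_completion.
Context (R : realType) (E : ptopologicalType).

(** The state space with its universally measurable sets, on which the tilted semigroups act. The
    generating family is already a sigma-field. *)
Definition universal_borel := g_sigma_algebraType (@universally_measurable R E).

Lemma universally_measurable_sigma_algebra :
  sigma_algebra setT (@universally_measurable R E).
Proof.
split.
- by move=> mu; case: (completion_sigma_algebra mu).
- by move=> A UA mu; case: (completion_sigma_algebra mu) => _ + _; apply; exact: UA.
- move=> A_ UA mu; case: (completion_sigma_algebra mu) => _ _ + ; apply => n.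
  exact: UA.
Qed.

Lemma universal_borelE (A : set universal_borel) :
  measurable A <-> universally_measurable R A.
Proof.
rewrite /measurable/= -[X in X <-> _]/(<<s universally_measurable R (E:=E) >> A).
by rewrite (sigma_algebra_id universally_measurable_sigma_algebra).
Qed.

Lemma borel_universal_borel (A : set E) :
  <<s @open E >> A -> @measurable _ universal_borel A.
Proof.
move=> mA; apply/universal_borelE => mu; exists A, A; split => //.
by rewrite setDv measure0.
Qed.

Lemma measurable_borel_universal d (T : measurableType d) (f : E -> T) :
  measurable_fun setT (f : borel E -> T) ->
  measurable_fun setT (f : universal_borel -> T).
Proof.
move=> mf _ V mV; rewrite setTI; apply: borel_universal_borel.
by have := mf measurableT V mV; rewrite setTI.
Qed.

(** Preimages under [f] and [g] agree off a [mu]-null set, so those under [f] lie in the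
    [mu]-completion. Both [g] and [N] may depend on [mu]. *)
Lemma measurable_universal d (T : measurableType d) (f : E -> T) :
  (forall mu : probability (borel E) R, exists (g : borel E -> T) (N : set (borel E)),
    [/\ measurable_fun setT g, measurable N, mu N = 0%E &
        forall x, ~ N x -> f x = g x]) ->
  measurable_fun setT (f : universal_borel -> T).
Proof.
move=> fg _ V mV; rewrite setTI; apply/universal_borelE => mu.
have [g [N [mg mN N0 eq_fg]]] := fg mu.
apply: (@completion_eq_off_null _ _ _ _ _ (g @^-1` V) N) => //.
  by rewrite -[_ @^-1` _]setTI; exact: mg.
by move=> x Nx; rewrite /preimage/= eq_fg.
Qed.

End universal_completion.

(** A singleton is the preimage of a singleton of the metric space under the injective embedding.
    This makes the event {X_0 = x} measurable. *)
Lemma lusin_closed1 (R : realType) (E : topologicalType) (x : E) :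
  lusin_space R E -> closed [set x].
Proof.
move=> [K [f [_ injf oE _]]].
rewrite -[[set x]]setCK; apply: open_closedC; rewrite oE.
exists (~` [set f x]).
  apply: closed_openC; apply: accessible_closed_set1.
  by apply: hausdorff_accessible; exact: metric_hausdorff.
by apply/seteqP; split => y /=; apply: contra_not; [move=> ->|move=> /injf].
Qed.

(** * The Markov property for augmented events *)

Section right_process.
Context (R : realType) (E : ptopologicalType).
Context d (Omega : measurableType d).
Variables (X : R -> Omega -> E) (theta : R -> Omega -> Omega).
Variable P : E -> probability Omega R.
Hypothesis HX : borel_right_process X theta P.
Local Notation E' := (universal_borel R E).
Local Notation raw := (raw_sigma_field X).

Let raw_sigma : sigma_algebra setT raw.
Proof. exact: smallest_sigma_algebra. Qed.

Let raw_setD A B : raw A -> raw B -> raw (A `\` B).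
Proof.
exact: (@measurableD _ (g_sigma_algebraType (cylinders X `[0, +oo[))).
Qed.

Lemma raw_measurable A : raw A -> measurable A.
Proof.
move=> rA; apply/(augmentedE HX) => mu; exists A, A; split => //.
by rewrite setDv /initial_law integral0_eq.
Qed.

Let le_P x A B : measurable A -> measurable B -> A `<=` B -> (P x A <= P x B)%E.
Proof. by move=> mA mB AB; apply: le_measure => //; exact: mem_set. Qed.

Let P_setD0 x A B : measurable A -> measurable B -> A `<=` B ->
  P x (B `\` A) = 0%E -> P x B = P x A.
Proof.
move=> mA mB AB BA0; apply/eqP; rewrite eq_le; apply/andP; split; last exact: le_P.
rewrite -(setDUK AB).
have := @measureU2 _ _ _ (P x) A (B `\` A) mA (measurableD mB mA).
by move=> /le_trans; apply; rewrite [X in (_ + X)%E]BA0 adde0.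
Qed.

Let measurable_X_borel t : 0 <= t ->
  measurable_fun setT (X t : Omega -> borel E).
Proof.
move=> t0 _ B mB; rewrite setTI; apply: raw_measurable; apply: sub_gen_smallest.
by exists t, B; split => //; rewrite /= in_itv/= t0.
Qed.

Let raw_X t B : 0 <= t -> <<s @open E >> B -> raw (X t @^-1` B).
Proof.
move=> t0 mB; apply: sub_gen_smallest; exists t, B; split => //.
by rewrite /= in_itv/= t0.
Qed.

Lemma initial_law_eq0 (mu : probability (borel E) R) A :
  raw A -> initial_law P mu A = 0%E ->
  exists N : set (borel E),
    [/\ measurable N, mu N = 0%E & forall x, ~ N x -> P x A = 0%E].
Proof.
by move=> rA; apply: ge0_integral_eq0_null => //; exact: (borel_kernel HX).
Qed.

(** An augmented event lies between raw events [B] and [C] that differ by a P_mu-null set; then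
    [C \ B] is P_x-null for mu-almost every x, and there P_x(A) equals the Borel function P_x(B). *)
Lemma measurable_universal_P A : measurable A ->
  measurable_fun setT ((fun x => P x A) : E' -> \bar R).
Proof.
move=> mA; apply: measurable_universal => mu.
have [B [C [rB rC BA AC CB0]]] := (augmentedE HX A).1 mA mu.
have [N [mN N0 PN]] := initial_law_eq0 (raw_setD rC rB) CB0.
exists (fun x => P x B), N; split => //; first exact: (borel_kernel HX).
move=> x /PN PCB; have [mB mC] := (raw_measurable rB, raw_measurable rC).
apply/eqP; rewrite eq_le; apply/andP; split; last exact: le_P.
by rewrite -(P_setD0 mB mC (subset_trans BA AC) PCB) le_P.
Qed.

Section law.
Variables (mu : probability (borel E) R) (t : R).
Hypothesis t0 : 0 <= t.

Let k (x : borel E) := image_measure (P x) (measurable_X_borel t0).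

Let mk B : measurable B -> measurable_fun setT (k ^~ B).
Proof.
move=> mB; rewrite (_ : k ^~ B = fun x => P x (X t @^-1` B)).
  by apply: (borel_kernel HX); exact: raw_X.
by apply/funext => x; rewrite /k image_measureE.
Qed.

(** The law of X_t under the initial law [mu]. Being a Borel probability, it can itself be the
    initial law in universal measurability and in the augmentation of the raw sigma-field. *)
Definition law_at : set (borel E) -> \bar R := mixture mu mk.

HB.instance Definition _ := Measure.on law_at.

Lemma law_atE B : measurable B -> law_at B = initial_law P mu (X t @^-1` B).
Proof. by move=> mB; apply: eq_integral => x _; rewrite /k image_measureE. Qed.

Let law_atT : law_at setT = 1%E.
Proof.
rewrite law_atE// /initial_law preimage_setT.
under eq_integral do rewrite probability_setT.
by rewrite integral_cst// mul1e; exact: probability_setT.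
Qed.

HB.instance Definition _ := Measure_isProbability.Build _ _ _
  law_at law_atT.

Definition probability_law_at : probability (borel E) R := law_at.

Lemma initial_law_law_at A : raw A ->
  initial_law P probability_law_at A = (\int[mu]_x \int[P x]_w P (X t w) A)%E.
Proof.
move=> rA; rewrite /initial_law integral_mixture//; last exact: (borel_kernel HX).
apply: eq_integral => x _; rewrite /k integral_image_measure//.
exact: (borel_kernel HX).
Qed.

Lemma measurable_expectation_law_at A : raw A ->
  measurable_fun setT
    ((fun x => \int[P x]_w P (X t w) A)%E : borel E -> \bar R).
Proof.
move=> rA; rewrite (_ : (fun _ => _) = fun x => \int[k x]_y P y A)%E.
  by apply: measurable_fun_integral_kernel => //; exact: (borel_kernel HX).
apply/funext => x; rewrite /k integral_image_measure//.
exact: (borel_kernel HX).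
Qed.

End law.

Lemma sub_raw_filtration s t : s <= t -> raw_filtration X s `<=` raw_filtration X t.
Proof.
move=> st; apply: smallest_sub; first exact: smallest_sigma_algebra.
move=> A [u [B [/= us mB ->]]]; apply: sub_gen_smallest; exists u, B; split => //.
by move: us; rewrite /= !in_itv/= => /andP[-> /le_trans]; apply.
Qed.

Lemma raw_filtration_filtration t A :
  raw_filtration X t A -> filtration X P t A.
Proof. by move=> rA mu; apply: sub_gen_smallest; left. Qed.

Lemma filtration_mono s t : s <= t -> filtration X P s `<=` filtration X P t.
Proof.
move=> st A FA mu; move: (FA mu); apply: smallest_sub; first exact: smallest_sigma_algebra.
move=> B [rB|nB]; apply: sub_gen_smallest; [left|by right].
exact: sub_raw_filtration rB.
Qed.

(** Sandwich [B] between Borel sets relative to the law of X_t under P_mu. The preimage of the inner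
    set is raw, and what remains lies in a P_mu-null raw event. *)
Lemma filtration_X t B : 0 <= t -> @measurable _ E' B ->
  filtration X P t (X t @^-1` B).
Proof.
move=> t0 /universal_borelE UB mu.
have [B0 [C0 [mB0 mC0 B0B BC0 CB0]]] := UB (probability_law_at mu t0).
have -> : X t @^-1` B = X t @^-1` B0 `|` X t @^-1` (B `\` B0).
  rewrite -preimage_setU; congr (_ @^-1` _).
  by rewrite setDUK.
apply: (@measurableU _ (g_sigma_algebraType
  (raw_filtration X t `|` null_sets X P mu))); apply: sub_gen_smallest.
  left; apply: sub_gen_smallest; exists t, B0; split => //.
  by rewrite /= in_itv/= t0 lexx.
right; exists (X t @^-1` (C0 `\` B0)); split.
- by apply: raw_X => //; exact: (@measurableD _ (borel E)).
- rewrite -(law_atE mu t0)//; exact: (@measurableD _ (borel E)).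
- by apply: preimage_subset; exact: setSD.
Qed.

Lemma measurable_X t : 0 <= t -> measurable_fun setT (X t : Omega -> E').
Proof.
move=> t0 _ B /universal_borelE UB; rewrite setTI; apply/(augmentedE HX) => mu.
have [B0 [C0 [mB0 mC0 B0B BC0 CB0]]] := UB (probability_law_at mu t0).
exists (X t @^-1` B0), (X t @^-1` C0); split.
- exact: raw_X.
- exact: raw_X.
- exact: preimage_subset.
- exact: preimage_subset.
- rewrite -[LHS]/(initial_law P mu (X t @^-1` (C0 `\` B0))) -(law_atE mu t0)//; exact: (@measurableD _ (borel E)).
Qed.

Let filtrationT t : filtration X P t setT.
Proof.
by move=> mu; exact: (@measurableT _ (g_sigma_algebraType
  (raw_filtration X t `|` null_sets X P mu))).
Qed.

(** The strong Markov property at the constant stopping time [s]. *)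
Lemma simple_markov s x H A : 0 <= s -> measurable H -> filtration X P s H ->
  raw A ->
  P x (H `&` theta s @^-1` A) = (\int[P x]_(w in H) P (X s w) A)%E.
Proof.
move=> s0 mH FH rA.
have F0 t : filtration X P t set0.
  by move=> mu; exact: (@measurable0 _ (g_sigma_algebraType
    (raw_filtration X t `|` null_sets X P mu))).
have sT : stopping_time (filtration X P) (cst s%:E).
  split=> [w|t t0]; first by rewrite lee_fin.
  have [st|st] := boolP (s <= t).
    by rewrite (_ : [set _ | _] = setT)//; apply/seteqP; split => // w _ /=; rewrite lee_fin.
  rewrite (_ : [set _ | _] = set0)//; apply/seteqP; split => // w /=.
  by rewrite lee_fin (negbTE st).
have sH : stopped_sigma_field (filtration X P) (cst s%:E) H.
  split => // t t0; have [st|st] := boolP (s <= t).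
    rewrite (_ : [set _ | _] = setT) ?setIT; first exact: filtration_mono FH.
    by apply/seteqP; split => // w _ /=; rewrite lee_fin.
  rewrite (_ : [set _ | _] = set0) ?setI0//; apply/seteqP; split => // w /=.
  by rewrite lee_fin (negbTE st).
have := strong_markov HX sT sH rA x.
rewrite (_ : [set w | (cst s%:E w < +oo)%E /\ _] = theta s @^-1` A); last first.
  by apply/seteqP; split => w /=; [case|split => //; exact: ltry].
rewrite (_ : [set w | (cst s%:E w < +oo)%E] = setT) ?setIT//.
by apply/seteqP; split => // w _ /=; exact: ltry.
Qed.

Lemma raw_theta s A : 0 <= s -> raw A -> raw (theta s @^-1` A).
Proof.
move=> s0; move: A.
apply: (@smallest_sub _ _ _ [set A | raw (theta s @^-1` A)]).
  case: raw_sigma => r0 rD rU; split => /=.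
  - by rewrite preimage_set0.
  - by move=> A /rD; rewrite !setTD.
  - by move=> F rF; rewrite preimage_bigcup; exact: rU.
move=> _ [u [B [/= + mB ->]]]; rewrite in_itv/= andbT => u0.
rewrite (_ : _ @^-1` _ = X (u + s) @^-1` B); first by apply: raw_X; rewrite ?addr_ge0.
by apply/seteqP; split => w; rewrite /preimage/= (shiftE HX).
Qed.

(** Sandwich [A] between raw events relative to the law of X_s as initial law; by the Markov
    property the shifted gap has the same probability under P_mu, namely zero. *)
Lemma measurable_theta s : 0 <= s -> measurable_fun setT (theta s).
Proof.
move=> s0 _ A mA; rewrite setTI; apply/(augmentedE HX) => mu.
have [B [C [rB rC BA AC CB0]]] := (augmentedE HX A).1 mA (probability_law_at mu s0).
exists (theta s @^-1` B), (theta s @^-1` C); split.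
- exact: raw_theta.
- exact: raw_theta.
- exact: preimage_subset.
- exact: preimage_subset.
rewrite -[LHS]/(initial_law P mu (theta s @^-1` (C `\` B))) -CB0 initial_law_law_at; last exact: raw_setD.
apply: eq_integral => x _.
rewrite -[theta s @^-1` _]setTI simple_markov//; exact: raw_setD.
Qed.

Let measurable_P_X s A : 0 <= s -> measurable A ->
  measurable_fun setT (fun w => P (X s w) A).
Proof.
by move=> s0 mA; apply: (measurableT_comp (measurable_universal_P mA) (measurable_X s0)).
Qed.

Lemma simple_markov_augmented s x H A : 0 <= s -> measurable H ->
  filtration X P s H -> measurable A ->
  P x (H `&` theta s @^-1` A) = (\int[P x]_(w in H) P (X s w) A)%E.
Proof.
move=> s0 mH FH mA.
(* With a Dirac initial law P_mu is P_x, so [A] is sandwiched relative to the law of X_s under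
   P_x. *)
pose mu : probability (borel E) R := \d_(x : borel E).
have [B [C [rB rC BA AC CB0]]] := (augmentedE HX A).1 mA (probability_law_at mu s0).
have [mB mC] := (raw_measurable rB, raw_measurable rC).
have mCB : measurable (C `\` B) by exact: measurableD.
have mPX D : measurable D -> measurable_fun H (fun w => P (X s w) D).
  by move=> mD; apply: measurable_funTS; exact: measurable_P_X.
have mth D : measurable D -> measurable (theta s @^-1` D).
  by move=> mD; rewrite -[_ @^-1` _]setTI; exact: measurable_theta.
have CB_eq0 : (P x (H `&` theta s @^-1` (C `\` B)) = 0)%E.
  rewrite simple_markov//; last exact: raw_setD.
  apply/eqP; rewrite eq_le integral_ge0// andbT.
  have <- : (\int[P x]_w P (X s w) (C `\` B) = 0)%E.
    rewrite -CB0 initial_law_law_at; last exact: raw_setD.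
    rewrite integral_dirac// ?diracT ?mul1e//.
    by apply: measurable_expectation_law_at => //; exact: raw_setD.
  by apply: ge0_subset_integral => //; exact: measurable_P_X.
have BC_eq : P x (H `&` theta s @^-1` C) = P x (H `&` theta s @^-1` B).
  apply: P_setD0.
  - by apply: measurableI => //; exact: mth.
  - by apply: measurableI => //; exact: mth.
  - by apply: setIS; apply: preimage_subset; exact: subset_trans AC.
  rewrite -CB_eq0; congr (P x _); apply/seteqP; split => w /=.
    by move=> [[Hw Cw] BHw]; split => //; split => // Bw; exact: BHw.
  by move=> [Hw [Cw Bw]]; split => // -[].
(* Both sides lie between their values for [B] and [C]. For these raw events the Markov property
   holds, and the two values coincide by [BC_eq]. *)
apply/eqP; rewrite eq_le; apply/andP; split.
  apply: (@le_trans _ _ (P x (H `&` theta s @^-1` C))).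
    apply: le_P.
    - by apply: measurableI => //; exact: mth.
    - by apply: measurableI => //; exact: mth.
    - by apply: setIS; exact: preimage_subset.
  rewrite BC_eq simple_markov//; apply: ge0_le_integral => //.
  - exact: mPX.
  - exact: mPX.
  - by move=> w _; exact: le_P.
apply: (@le_trans _ _ (P x (H `&` theta s @^-1` B))).
  rewrite -BC_eq simple_markov//; apply: ge0_le_integral => //.
  - exact: mPX.
  - exact: mPX.
  - by move=> w _; exact: le_P.
apply: le_P.
- by apply: measurableI => //; exact: mth.
- by apply: measurableI => //; exact: mth.
- by apply: setIS; exact: preimage_subset.
Qed.

End right_process.

(** * The Markov property for nonnegative functions *)

Section markov.
Context (R : realType) (E : ptopologicalType).
Context d (Omega : measurableType d).
Variables (X : R -> Omega -> E) (theta : R -> Omega -> Omega).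
Variable P : E -> probability Omega R.
Hypothesis HX : borel_right_process X theta P.
Local Notation E' := (universal_borel R E).

Lemma measurable_expectation (f : Omega -> \bar R) :
  measurable_fun setT f -> (forall w, 0 <= f w)%E ->
  measurable_fun setT ((fun x => \int[P x]_w f w)%E : E' -> \bar R).
Proof.
move=> mf f0; apply: (measurable_fun_integral_kernel (l := fun x : E' => P x)) => //.
by move=> A; exact: (measurable_universal_P HX).
Qed.

Lemma markov_on_event s x H (f : Omega -> \bar R) : 0 <= s -> measurable H ->
  filtration X P s H -> measurable_fun setT f -> (forall w, 0 <= f w)%E ->
  (\int[P x]_(w in H) f (theta s w) = \int[P x]_(w in H) \int[P (X s w)]_v f v)%E.
Proof.
move=> s0 mH FH; move: f; apply: ge0_linear_ext.
- apply: ge0_linear_integral => // f mf f0.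
  by apply: measurable_funTS; apply: measurableT_comp => //; exact: (measurable_theta HX).
- apply: ge0_linear_integral => //.
    by move=> w; exact: ge0_linear_integral_id.
  move=> f mf f0.
  apply: measurable_funTS; apply: (measurableT_comp (measurable_expectation mf f0)).
  exact: (measurable_X HX).
move=> A mA; under [RHS]eq_integral do rewrite integral_indic// setIT.
rewrite -(simple_markov_augmented HX)//.
have mthA : measurable (theta s @^-1` A).
  by rewrite -[_ @^-1` _]setTI; exact: (measurable_theta HX).
rewrite -[LHS]/(\int[P x]_(w in H) (\1_(theta s @^-1` A) w)%:E)%E.
by rewrite integral_indic// setIC.
Qed.

(** The densities [Y \o theta s] and E_{X_s}[Y] have equal integrals over every event {Z in B},
    which belongs to F_s. Hence their images under [Z] are the same measure on the line, and
    integrating |z| against it recovers the factor [Z >= 0]. *)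
Lemma markov s x (Z Y : Omega -> R) : 0 <= s ->
  (forall w, 0 <= Z w) -> measurable_fun setT Z ->
  (forall B, measurable B -> filtration X P s (Z @^-1` B)) ->
  (forall w, 0 <= Y w) -> measurable_fun setT Y ->
  (forall y, \int[P y]_w (Y w)%:E < +oo)%E ->
  (\int[P x]_w (Z w * Y (theta s w))%:E =
   \int[P x]_w ((Z w)%:E * \int[P (X s w)]_v (Y v)%:E))%E.
Proof.
move=> s0 Z0 mZ FZ Y0 mY Yoo.
have YE0 w : (0 <= (Y w)%:E)%E by rewrite lee_fin.
have mYE : measurable_fun setT (EFin \o Y) by exact/measurable_EFinP.
pose W w := fine (\int[P (X s w)]_v (Y v)%:E)%E.
have WE w : (\int[P (X s w)]_v (Y v)%:E = (W w)%:E)%E.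
  by rewrite fineK// ge0_fin_numE// integral_ge0.
have W0 w : 0 <= W w by apply/fine_ge0/integral_ge0.
have mW : measurable_fun setT W.
  apply/measurable_EFinP; rewrite (_ : _ \o _ =
    (fun y => \int[P y]_v (Y v)%:E)%E \o X s); last by apply/funext => w /=; rewrite WE.
  by apply: (measurableT_comp (measurable_expectation mYE YE0)); exact: (measurable_X HX).
have mYth : measurable_fun setT (Y \o theta s).
  by apply: measurableT_comp => //; exact: (measurable_theta HX).
have Yth0 w : 0 <= (Y \o theta s) w by exact: Y0.
have mabs : measurable_fun setT (fun z : R => `|z|%:E).
  by apply/measurable_EFinP; exact: normr_measurable.
transitivity (\int[density_pushforward (P x) Yth0 mYth mZ]_z `|z|%:E)%E.
  rewrite integral_density_pushforward//.
  by apply: eq_integral => w _; rewrite ger0_norm// -EFinM mulrC.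
transitivity (\int[density_pushforward (P x) W0 mW mZ]_z `|z|%:E)%E.
  apply: eq_measure_integral => B mB _ /=; rewrite /density_pushforward.
  have mZB : measurable (Z @^-1` B) by rewrite -[_ @^-1` _]setTI; exact: mZ.
  rewrite (markov_on_event x (f := EFin \o Y) s0 mZB)//; last exact: FZ.
  by apply: eq_integral => w _; exact: WE.
rewrite integral_density_pushforward//.
by apply: eq_integral => w _; rewrite ger0_norm// WE muleC.
Qed.

End markov.

(** * Uniqueness of the factorization *)

Section tilted_semigroup.
Context (R : realType) (E : ptopologicalType).
Context d (Omega : measurableType d).
Variables (X : R -> Omega -> E) (theta : R -> Omega -> Omega).
Variable P : E -> probability Omega R.
Hypothesis HX : borel_right_process X theta P.
Variable S : R -> Omega -> R.
Hypothesis HS : pricing_kernel X theta P S.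
Local Notation E' := (universal_borel R E).

Lemma HS_measurable lam pi M t : HS_factorization X P S lam pi M ->
  0 <= t -> measurable_fun setT (M t).
Proof.
move=> H t0; have [_ /(_ t t0) + _] := hs_martingale H point.
by move=> /measurable_int /measurable_EFinP.
Qed.

(** Multiplicativity of [S] passes to [M], since the exponentials multiply and the ratios of [pi]
    telescope through X_s. *)
Lemma HS_multiplicative lam pi M s t w : HS_factorization X P S lam pi M ->
  0 <= s -> 0 <= t -> M (s + t) w = M s w * M t (theta s w).
Proof.
move=> H s0 t0; rewrite !(hs_martingaleE H)// ?addr_ge0//.
rewrite (pk_mul HS)// !(shiftE HX)// add0r (addrC t s) mulrDr expRD.
have p0 y : pi y != 0 by rewrite gt_eqF// (hs_pi_gt0 H).
by field; rewrite !p0.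
Qed.

Section kernel.
Variables (lam : R) (pi : E -> R) (M : R -> Omega -> R).
Hypothesis HM : HS_factorization X P S lam pi M.

Let M_ge0 (t : R) w : 0 <= M `|t| w.
Proof. by rewrite ltW// (hs_gt0 HM). Qed.

Let mM (t : R) : measurable_fun setT (M `|t|).
Proof. by apply: (HS_measurable HM). Qed.

Let mX (t : R) : measurable_fun setT (X `|t| : Omega -> E').
Proof. exact: (measurable_X HX). Qed.

(* [`|t|] only makes the definition total in [t]. *)
Definition tilted_kernel (t : R) (x : E') : {measure set E' -> \bar R} :=
  density_pushforward (P x) (M_ge0 t) (mM t) (mX t).

Lemma tilted_kernelE t x B : 0 <= t ->
  tilted_kernel t x B = (\int[P x]_(w in X t @^-1` B) (M t w)%:E)%E.
Proof. by move=> t0; rewrite /tilted_kernel/= /density_pushforward ger0_norm. Qed.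

Lemma integral_tilted_kernel t x (f : E' -> \bar R) : 0 <= t ->
  measurable_fun setT f -> (forall y, 0 <= f y)%E ->
  (\int[tilted_kernel t x]_y f y = \int[P x]_w ((M t w)%:E * f (X t w)))%E.
Proof.
move=> t0 mf f0; rewrite integral_density_pushforward//.
by under eq_integral do rewrite ger0_norm//.
Qed.

(** The martingale [M] keeps its initial mean, and M_0 = 1. *)
Lemma tilted_kernelT t x : 0 <= t -> tilted_kernel t x setT = 1%E.
Proof.
move=> t0; rewrite tilted_kernelE// preimage_setT.
have [_ _ mart] := hs_martingale HM x.
rewrite (mart 0 t)//; last first.
  by move=> mu; exact: (@measurableT _ (g_sigma_algebraType
    (raw_filtration X 0 `|` null_sets X P mu))).
under eq_integral do rewrite (hs_0 HM).
by rewrite integral_cst// mul1e; exact: probability_setT.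
Qed.

Let M_pos t w : 0 <= t -> 0 <= M t w.
Proof. by move=> t0; rewrite ltW// (hs_gt0 HM). Qed.

Let mMt t : 0 <= t -> measurable_fun setT (M t).
Proof. exact: (HS_measurable HM). Qed.

Lemma measurable_tilted_kernel t B : 0 <= t -> measurable B ->
  measurable_fun setT (fun x => tilted_kernel t x B).
Proof.
move=> t0 mB; rewrite (_ : (fun _ => _) = fun x : E' =>
    (\int[P x]_w ((M t w)%:E * (\1_B (X t w))%:E))%E); last first.
  apply/funext => x; rewrite -(integral_tilted_kernel x (f := fun y => (\1_B y)%:E))//.
    by rewrite integral_indic// setIT.
  exact/measurable_EFinP.
apply: (measurable_expectation HX) => [|w]; last first.
  by rewrite -EFinM lee_fin mulr_ge0// M_pos.
apply: emeasurable_funM; apply/measurable_EFinP; first exact: mMt.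
apply: (measurableT_comp (f := \1_B : E' -> R)) => //; exact: (measurable_X HX).
Qed.

(** Chapman-Kolmogorov under the eigen-measure: apply the Markov property with Z = M_s and Y = M_t
    f(X_t), using multiplicativity of [M]. The bound [c] makes the mean of [Y] finite. *)
Lemma tilted_kernelD s t x (f : E' -> R) c : 0 <= s -> 0 <= t ->
  measurable_fun setT f -> (forall y, 0 <= f y <= c) ->
  (\int[tilted_kernel (s + t) x]_y (f y)%:E =
   \int[tilted_kernel s x]_y \int[tilted_kernel t y]_z (f z)%:E)%E.
Proof.
move=> s0 t0 mf fc.
have f0 y : 0 <= f y by case/andP: (fc y).
have fE0 y : (0 <= (f y)%:E)%E by rewrite lee_fin.
have mfE : measurable_fun setT (EFin \o f) by exact/measurable_EFinP.
pose Y w := M t w * f (X t w).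
have mY : measurable_fun setT Y.
  apply: measurable_funM; first exact: mMt.
  by apply: (measurableT_comp mf); exact: (measurable_X HX).
have Y0 w : 0 <= Y w by rewrite mulr_ge0// M_pos.
have YE y : (\int[P y]_w (Y w)%:E = \int[tilted_kernel t y]_z (f z)%:E)%E.
  by rewrite integral_tilted_kernel//; apply: eq_integral => w _; rewrite EFinM.
rewrite (integral_tilted_kernel (t := s)) => //; last 2 first.
- apply: measurable_fun_integral_kernel => // B mB.
  exact: measurable_tilted_kernel.
- by move=> y; exact: integral_ge0.
under [RHS]eq_integral do rewrite -YE.
rewrite -(markov HX)//.
- rewrite integral_tilted_kernel// ?addr_ge0//; apply: eq_integral => w _.
  by rewrite (HS_multiplicative w HM)// /Y (shiftE HX)// (addrC t) mulrA.
- by move=> w; exact: M_pos.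
- exact: mMt.
- by have [+ _ _] := hs_martingale HM x; apply.
move=> y; rewrite YE; apply: (@le_lt_trans _ _ (\int[tilted_kernel t y]_z c%:E)%E).
  by apply: ge0_le_integral => // z _; rewrite lee_fin; case/andP: (fc z).
by rewrite integral_cst// [X in (_ * X)%E]tilted_kernelT// mule1 ltry.
Qed.

Lemma tilted_kernel_recurrent Q : eigen_measure X P M Q ->
  recurrent (transition_function X Q) -> forall B : set E', measurable B ->
  (forall x, \int[lebesgue_measure]_(t in `[0%R, +oo[) tilted_kernel t x B = 0)%E \/
  (forall x, \int[lebesgue_measure]_(t in `[0%R, +oo[) tilted_kernel t x B = +oo)%E.
Proof.
move=> HQ rec B mB.
have potE x : (\int[lebesgue_measure]_(t in `[0%R, +oo[) tilted_kernel t x B =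
    potential (transition_function X Q) x B)%E.
  apply: eq_integral => t /set_mem/=; rewrite in_itv/= andbT => t0.
  by rewrite /transition_function (HQ x t)// ?tilted_kernelE//; exact: (filtration_X HX).
by have [] := rec B ((universal_borelE B).1 mB) => h; [left|right] => x; rewrite potE.
Qed.

End kernel.
End tilted_semigroup.

(** * Comparison of two factorizations *)

Section uniqueness.
Context (R : realType) (E : ptopologicalType) (lusinE : lusin_space R E).
Context d (Omega : measurableType d).
Variables (X : R -> Omega -> E) (theta : R -> Omega -> Omega).
Variable P : E -> probability Omega R.
Hypothesis HX : borel_right_process X theta P.
Variable S : R -> Omega -> R.
Hypothesis HS : pricing_kernel X theta P S.
Local Notation E' := (universal_borel R E).

(** Since P_x(X_0 = x) = 1, functions of X_0 may be replaced under P_x by their values at x. *)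
Lemma initial_state_ae x (f g : Omega -> \bar R) :
  measurable_fun setT f -> measurable_fun setT g ->
  (forall w, 0 <= f w)%E -> (forall w, 0 <= g w)%E ->
  (forall w, X 0 w = x -> f w = g w) ->
  (\int[P x]_w f w = \int[P x]_w g w)%E.
Proof.
move=> mf mg f0 g0 fg.
have mx : measurable (X 0 @^-1` [set x]).
  rewrite -[_ @^-1` _]setTI; apply: (measurable_X HX) => //.
  apply: borel_universal_borel; rewrite -[[set x]]setCK; apply: sigma_algebraC.
  by apply: sub_gen_smallest; exact/closed_openC/lusin_closed1/lusinE.
apply: ge0_ae_eq_integral => //; exists (~` (X 0 @^-1` [set x])); split.
- exact: measurableC.
- apply: (etrans (probability_setC (P x) mx)).
  by rewrite [X in (_ - X)%E](Defs.normalE HX) subee.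
- by move=> w /=; apply: contra_not => Xw _; exact: fg.
Qed.

Lemma measurable_eigenfunction lam pi M : HS_factorization X P S lam pi M ->
  measurable_fun setT (pi : E' -> R).
Proof. by move=> H; apply: measurable_borel_universal; exact: (hs_borel H). Qed.

Lemma measurable_eigenfunction_ratio lam1 lam2 pi1 pi2 M1 M2 :
  HS_factorization X P S lam1 pi1 M1 -> HS_factorization X P S lam2 pi2 M2 ->
  measurable_fun setT (fun x : E' => pi2 x / pi1 x).
Proof.
move=> H1 H2.
(* The quotient of positive functions is written as the exponential of a difference of logarithms,
   whose measurability is immediate. *)
rewrite (_ : (fun _ => _) = fun x => expR (ln (pi2 x) - ln (pi1 x))).
  apply: measurableT_comp => //; apply: measurable_funB; apply: measurableT_comp.
  - exact: measurable_ln.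
  - exact: measurable_eigenfunction H2.
  - exact: measurable_ln.
  - exact: measurable_eigenfunction H1.
apply/funext => x; rewrite expRD expRN !lnK// posrE.
  exact: (hs_pi_gt0 H1).
exact: (hs_pi_gt0 H2).
Qed.

(** Under P_x, the product of M1_t with the ratio at X_t is e^(lam1 t) S_t pi2(X_t) / pi1(x); the
    eigenvalue equation of [pi2] then gives its mean. *)
Lemma tilted_kernel_eigenfunction_ratio lam1 lam2 pi1 pi2 M1 M2
    (H1 : HS_factorization X P S lam1 pi1 M1)
    (H2 : HS_factorization X P S lam2 pi2 M2) t x : 0 <= t ->
  (\int[tilted_kernel HX H1 t x]_y (pi2 y / pi1 y)%:E =
   (expR ((lam1 - lam2) * t) * (pi2 x / pi1 x))%:E)%E.
Proof.
move=> t0; have p1 y : 0 < pi1 y by exact: (hs_pi_gt0 H1).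
have p2 y : 0 < pi2 y by exact: (hs_pi_gt0 H2).
have mh := measurable_eigenfunction_ratio H1 H2.
have M1_0 w : 0 <= M1 t w by rewrite ltW// (hs_gt0 H1).
have M2_0 w : 0 <= M2 t w by rewrite ltW// (hs_gt0 H2).
have mM1 := HS_measurable H1 t0; have mM2 := HS_measurable H2 t0.
rewrite integral_tilted_kernel//; last 2 first.
- exact/measurable_EFinP.
- by move=> y; rewrite lee_fin divr_ge0// ltW.
(* The second factorization expresses S_t pi2(X_t) through the measurable [M2 t], which yields its
   measurability. *)
have Spi2E w : (S t w * pi2 (X t w))%:E =
    ((expR (- lam2 * t))%:E * (pi2 (X 0 w) * M2 t w)%:E)%E.
  rewrite -EFinM; congr EFin; rewrite (hs_identity H2)//.
  by field; rewrite gt_eqF.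
have mSpi2 : measurable_fun setT (fun w => (S t w * pi2 (X t w))%:E).
  under eq_fun do rewrite Spi2E.
  apply: measurable_funeM; apply/measurable_EFinP; apply: measurable_funM => //.
  apply: (measurableT_comp (measurable_eigenfunction H2)).
  exact: (measurable_X HX).
have Spi2_ge0 w : (0 <= (S t w * pi2 (X t w))%:E)%E.
  by rewrite Spi2E -EFinM lee_fin !mulr_ge0// ?expR_ge0// ltW.
pose c := expR (lam1 * t) / pi1 x.
have c0 : 0 <= c by rewrite divr_ge0 ?expR_ge0// ltW.
transitivity (\int[P x]_w (c%:E * (S t w * pi2 (X t w))%:E))%E.
  apply: initial_state_ae.
  - apply: emeasurable_funM; first exact/measurable_EFinP.
    apply/measurable_EFinP; apply: (measurableT_comp mh).
    exact: (measurable_X HX).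
  - exact: measurable_funeM.
  - by move=> w; rewrite -EFinM lee_fin mulr_ge0// divr_ge0// ltW.
  - by move=> w; rewrite mule_ge0.
  move=> w Xw; rewrite -!EFinM; congr EFin; rewrite (hs_martingaleE H1)// Xw /c.
  by field; rewrite !gt_eqF.
rewrite ge0_integralZl_EFin//.
have := hs_eigen H2 x t0; rewrite /pricing_operator => ->.
rewrite -EFinM; congr EFin; rewrite /c mulrBl expRD -mulNr.
by field; rewrite gt_eqF.
Qed.

(** The order of the eigenvalues makes [pi2 / pi1] an eigenfunction of the first tilted semigroup
    with exponent [lam1 - lam2 <= 0], so the results on recurrent semigroups apply. *)
Lemma recurrent_factorization_unique_le lam1 lam2 pi1 pi2 M1 M2 Q1 Q2 :
  recurrent_HS_factorization X P S lam1 pi1 M1 Q1 ->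
  recurrent_HS_factorization X P S lam2 pi2 M2 Q2 ->
  lam1 <= lam2 ->
  lam1 = lam2 /\ exists c, 0 < c /\ forall x, pi2 x = c * pi1 x.
Proof.
move=> [H1 HQ1 rec1] [H2 _ _] lam12.
have p1 y : 0 < pi1 y by exact: (hs_pi_gt0 H1).
have p2 y : 0 < pi2 y by exact: (hs_pi_gt0 H2).
have h0 y : 0 < pi2 y / pi1 y by rewrite divr_gt0.
have lam_le0 : lam1 - lam2 <= 0 by rewrite subr_le0.
have mK := measurable_tilted_kernel HX H1.
have KT := tilted_kernelT HX H1.
have KD := tilted_kernelD HX HS H1.
have Krec := tilted_kernel_recurrent HX H1 HQ1 rec1.
have mh := measurable_eigenfunction_ratio H1 H2.
have Kh := tilted_kernel_eigenfunction_ratio H1 H2.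
split.
  by apply/eqP; rewrite -subr_eq0; apply/eqP;
    exact: (recurrent_eigenvalue_eq0 mK KT KD Krec mh h0 lam_le0 Kh).
have hle := recurrent_eigenfunction_cst mK KT KD Krec mh h0 lam_le0 Kh.
exists (pi2 point / pi1 point); split => // x.
have -> : pi2 point / pi1 point = pi2 x / pi1 x by apply/eqP; rewrite eq_le !hle.
by rewrite divfK// gt_eqF.
Qed.

Lemma recurrent_factorization_unique lam1 lam2 pi1 pi2 M1 M2 Q1 Q2 :
  recurrent_HS_factorization X P S lam1 pi1 M1 Q1 ->
  recurrent_HS_factorization X P S lam2 pi2 M2 Q2 ->
  lam1 = lam2 /\ exists c, 0 < c /\ forall x, pi2 x = c * pi1 x.
Proof.
move=> H1 H2; have [|/ltW] := leP lam1 lam2.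
  exact: recurrent_factorization_unique_le H1 H2.
move=> /(recurrent_factorization_unique_le H2 H1)[-> [c [c0 pi12]]].
split => //; exists c^-1; split => [|x]; first by rewrite invr_gt0.
by rewrite pi12 mulKf// gt_eqF.
Qed.

End uniqueness.

(** The union of the raw filtration is stable under intersection, since two of its events share the
    later time, and it generates the raw sigma-field; probabilities agreeing on it are equal. *)
Lemma raw_law_unique (R : realType) (E : ptopologicalType) d
    (Omega : measurableType d) (X : R -> Omega -> E)
    (m1 m2 : probability (g_sigma_algebraType (cylinders X `[0, +oo[)) R) :
  (forall t A, 0 <= t -> raw_filtration X t A -> m1 A = m2 A) ->
  forall A, raw_sigma_field X A -> m1 A = m2 A.
Proof.
move=> m12; pose G := [set A | exists2 t, 0 <= t & raw_filtration X t A].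
have rawG A : G A -> raw_sigma_field X A.
  case=> t t0; apply: smallest_sub; first exact: smallest_sigma_algebra.
  move=> B [s [C [/= + mC ->]]]; rewrite in_itv/= => /andP[s0 _].
  by apply: sub_gen_smallest; exists s, C; split => //; rewrite /= in_itv/= s0.
have GT : G setT.
  exists 0 => //; exact: (@measurableT _ (g_sigma_algebraType (cylinders X `[0, 0]))).
have GI : setI_closed G.
  move=> A B [s s0 As] [t t0 Bt]; exists (Num.max s t); first by rewrite le_max s0.
  apply: (@measurableI _ (g_sigma_algebraType (cylinders X `[0, Num.max s t]))).
    by apply: sub_raw_filtration As; rewrite le_max lexx.
  by apply: sub_raw_filtration Bt; rewrite le_max lexx orbT.
move=> A rA; apply: (@g_sigma_algebra_measure_unique _ R
  (g_sigma_algebraType (cylinders X `[0, +oo[)) G _ (fun=> setT) _ _ m1 m2) => //.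
- by rewrite bigcup_const//; exists 0%N.
- by move=> B [t t0 Bt]; exact: m12 Bt.
- by move=> k; rewrite (le_lt_trans (probability_le1 _ _)) ?ltry.
move: rA; apply: smallest_sub; first exact: smallest_sigma_algebra.
move=> _ [s [B [/= + mB ->]]]; rewrite in_itv/= andbT => s0.
apply: sub_gen_smallest; exists s => //; apply: sub_gen_smallest.
by exists s, B; split => //; rewrite /= in_itv/= s0 lexx.
Qed.

Theorem theorem3p2 (R : realType) (E : ptopologicalType)
  (lusinE : lusin_space R E) (E_two_points : exists a b : E, a <> b)
  (d : measure_display) (Omega : measurableType d)
  (X : R -> Omega -> E) (theta : R -> Omega -> Omega)
  (P : E -> probability Omega R)
  (right_processX : borel_right_process X theta P)
  (S : R -> Omega -> R) (kernelS : pricing_kernel X theta P S)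
  (lam1 lam2 : R) (pi1 pi2 : E -> R) (M1 M2 : R -> Omega -> R)
  (Q1 Q2 : E -> set Omega -> \bar R)
  (fact1 : recurrent_HS_factorization X P S lam1 pi1 M1 Q1)
  (fact2 : recurrent_HS_factorization X P S lam2 pi2 M2 Q2) :
  [/\ lam1 = lam2,
      (exists c : R, 0 < c /\ forall x, pi2 x = c * pi1 x),
      (forall (t : R) w, 0 <= t -> M1 t w = M2 t w),
      (forall x (t : R) A, 0 <= t -> filtration X P t A -> Q1 x A = Q2 x A) &
      (forall m1 m2 :
         E -> probability (g_sigma_algebraType (cylinders X `[0, +oo[)) R,
       extends_eigen_measure Q1 m1 -> extends_eigen_measure Q2 m2 ->
       forall x A, raw_sigma_field X A -> m1 x A = m2 x A)].
Proof.
have [lam12 [c [c0 pi12]]] :=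
  recurrent_factorization_unique lusinE right_processX kernelS fact1 fact2.
have [[H1 HQ1 _] [H2 HQ2 _]] := (fact1, fact2).
(* The constant [c] cancels in pi(X_t) / pi(X_0). *)
have M12 t w : 0 <= t -> M1 t w = M2 t w.
  move=> t0; rewrite (hs_martingaleE H1)// (hs_martingaleE H2)// lam12 !pi12.
  by congr (_ * _ * _); field; rewrite !gt_eqF// (hs_pi_gt0 H1).
have Q12 x t A : 0 <= t -> filtration X P t A -> Q1 x A = Q2 x A.
  move=> t0 FA; rewrite (HQ1 x t)// (HQ2 x t)//.
  by apply: eq_integral => w _; rewrite M12.
split => //; first by exists c.
move=> m1 m2 mQ1 mQ2 x; apply: raw_law_unique => t A t0 rA.
rewrite (mQ1 x t)// (mQ2 x t)//; apply: (Q12 x t) => //; exact: raw_filtration_filtration.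
Qed.
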